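(* Let $f>1$ be an integer and $\eta>1$ a real number. The online algorithm Harmonic-Stretch for the $(f,\eta)$-fault-tolerant bin packing problem has (asymptotic) competitive ratio at most $1.75$; that is, there is a constant $c$ (possibly depending on $f$ and $\eta$, but independent of the input length) such that for every input sequence $\sigma$, and every pattern of bin failures and recoveries with at most $f$ bins failed at any time, the number $HS(\sigma)$ of bins opened by Harmonic-Stretch for $\sigma$ satisfies $HS(\sigma)\le 1.75\cdot \mathrm{Opt}(\sigma)+c$.
   Context: **Problem.** Let $f>1$ be an integer and $\eta>1$ real. In the $(f,\eta)$-fault-tolerant bin packing problem, a sequence $\sigma$ of items with sizes in $(0,1]$ is revealed online. When an item of size $x$ arrives, the algorithm places a primary replica of size $x$ and $f$ standby replicas of size $x/\eta$ each into bins of unit capacity, without information about later items; the $f+1$ replicas are packed concurrently (no bin fails meanwhile), must lie in $f+1$ different bins, and are never moved afterwards. During the process bins may fail and failed bins may recover, with at most $f$ bins failed at any time. In a valid packing a primary replica of every item must always be available in a non-failed bin: upon failure of a bin with a primary replica of an item, a standby replica of it in a non-failed bin must be promoted to primary (its size growing from $x/\eta$ to $x$), without overloading any bin. The objective is to minimize the number of bins. **Optimal packing.** $\mathrm{Opt}(\sigma)$ is the minimum number of bins in an offline valid packing of $\sigma$: each item has its primary replica and $f$ standby replicas in $f+1$ different bins, each bin has total size at most $1$, and for every set $F$ of at most $f$ bins (the failed bins) one can choose, for each item whose primary replica lies in a bin of $F$, a standby replica of it in a bin not in $F$, so that after promoting the chosen replicas (all other replicas keeping their sizes) every bin not in $F$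 has total size at most $1$. **Algorithm Harmonic-Stretch (packing strategy).** (The status adjustments made on failures/recoveries do not affect the number of bins.) *Classes.* An item has primary class $i\in\{1,\dots,5\}$ if its primary replica has size in $(\frac1{i+1},\frac1i]$, class $6$ if in $(\frac1{7-1/\eta},\frac16]$, class $7$ if at most $\frac1{7-1/\eta}$. It has standby class $j\in\{1,\dots,\lfloor 6\eta\rfloor-1\}$ if its standby replicas have size in $(\frac1{j+\eta},\frac1{j+\eta-1}]$, class $\lfloor 6\eta\rfloor$ if in $(\frac1{7\eta-1},\frac1{\lfloor 6\eta\rfloor+\eta-1}]$, class $\lfloor 6\eta\rfloor+1$ if at most $\frac1{7\eta-1}$. An item of primary class $i$ and standby class $j$ is an $(i,j)$-item. It is small if $i=7$ (equivalently $j=\lfloor 6\eta\rfloor+1$), and regular otherwise. Items of different classes $(i,j)$ never share a bin. *Groups.* For each class $(i,j)$ the algorithm maintains groups of bins, one of which is the active group, into which arriving $(i,j)$-items are packed. A group is incomplete until it becomes complete (see below). A group is available if none of its bins is failed; the active group is always available. When the active group becomes complete or one of its bins fails, a new active group is selected: any incomplete available group if one exists, otherwise a fresh group of empty non-failed bins is opened. *Regular items.* A group for regular $(i,j)$-items has $j$ primary bins $B_0,\dots,B_{j-1}$, each split into $i$ spots of capacity $1/i$, and $fi$ standby bins $\beta^k_z$ ($1\le k\le f$, $0\le z\le i-1$), each split into $j$ spots (labelled $0,\dots,j-1$) of size $\frac1{j+\eta-1}$ (leaving a reserved space of $\frac{\eta-1}{j+\eta-1}$). For the $t$-th item of the group ($0\le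 t\le ij-1$), with $w=t \bmod j$ and $z=\lfloor t/j\rfloor$, the primary replica goes into spot $z$ of $B_w$ and the standby replicas into spot $w$ of $\beta^1_z,\dots,\beta^f_z$. The group is complete once $ij$ items are placed in it. *Small items.* Consecutive small items are merged into super-replicas (SRs): a primary SR has capacity $\frac2{7-1/\eta}$ and each of its $f$ corresponding standby SRs has capacity $\frac2{7\eta-1}$. A group for small items has $f$ mirroring standby bins (containing the same standby SRs) and one primary bin currently committed to it (which counts as a bin of the group). Primary bins not committed to any group are free. An arriving small item is placed into the currently open SRs of the active group: its standby replicas into the open standby SRs in the $f$ mirroring bins, its primary replica into the open primary SR in the committed bin. If it does not fit in the open SRs (capacity would be exceeded), these SRs are closed and new SRs must be opened: if the available space in the mirroring bins of the active group is at least $\frac{2\eta}{7\eta-1}$ (this keeps a reserved space of $\frac{2(\eta-1)}{7\eta-1}$), the $f$ new standby SRs are placed there; otherwise the active group becomes complete, a new active group for small items is selected (any incomplete available group for small items if one exists, otherwise a fresh group of empty non-failed bins is opened), and the item is processed with that group in the same way. To place the new primary SR, the bin committed to the active group is freed (the committed bin of a group that becomes complete is likewise freed), and any free non-failed primary bin $B'$ is selected that has empty space at least $\frac2{7-1/\eta}$ and shares no SR with the $f$ standby bins of the active group; if none exists a new primary bin $B'$ is opened. $B'$ becomes committed to the active group and receives the new primary SR. *)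

(* Defs.v *)
From mathcomp Require Import all_boot all_order all_algebra.
From mathcomp Require Import reals.
From mathcomp Require Import lra zify.
Set Implicit Arguments.
Unset Strict Implicit.
Unset Printing Implicit Defensive.
Import Order.TTheory GRing.Theory Num.Theory.
Local Open Scope ring_scope.

Section OfflinePacking.
Variables (R : realType) (f : nat) (eta : R).

Definition valid_size (x : R) : bool := 0 < x <= 1.

(* An offline packing of [xs] into [m] bins: item [i], of size [xs`_i], has its
   primary replica in bin [p i] and one standby replica in each bin of [s i]. *)
Section Packing.
Variables (xs : seq R) (m : nat).
Variables (p : {ffun 'I_(size xs) -> 'I_m}).
Variables (s : {ffun 'I_(size xs) -> {set 'I_m}}).

Definition bin_load (b : 'I_m) : R :=
  \sum_(i | p i == b) xs`_i + \sum_(i | b \in s i) xs`_i / eta.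

(* Extra load of [b] once, for every item [i] whose primary replica is in a bin
   of [F], the standby replica in bin [c i] has been promoted. *)
Definition promoted_load (F : {set 'I_m}) (c : {ffun 'I_(size xs) -> 'I_m})
    (b : 'I_m) : R :=
  \sum_(i | (p i \in F) && (c i == b)) (xs`_i - xs`_i / eta).

Definition tolerates (F : {set 'I_m}) : bool :=
  [exists c : {ffun 'I_(size xs) -> 'I_m},
    [forall i, (p i \in F) ==> (c i \in s i) && (c i \notin F)] &&
    [forall b, (b \notin F) ==> (bin_load b + promoted_load F c b <= 1)]].

Definition valid_packing : bool :=
  [&& [forall i, (#|s i| == f) && (p i \notin s i)],
      [forall b, bin_load b <= 1] &
      [forall F : {set 'I_m}, (#|F| <= f)%N ==> tolerates F]].

End Packing.

Definition packable (xs : seq R) (m : nat) : bool :=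
  [exists p : {ffun 'I_(size xs) -> 'I_m},
    [exists s : {ffun 'I_(size xs) -> {set 'I_m}}, valid_packing p s]].

Lemma packable_spread (xs : seq R) :
  1 < eta -> all valid_size xs -> packable xs (size xs * f.+1).
Proof.
move=> eta1 /allP hxs; set n := size xs; set m := (n * f.+1)%N.
have lt_bin (i : 'I_n) (k : 'I_f.+1) : (i * f.+1 + k < m)%N.
  have : (i.+1 * f.+1 <= n * f.+1)%N by rewrite leq_mul2r ltn_ord orbT.
  by rewrite mulSn /m; have := ltn_ord k; lia.
pose bin i k : 'I_m := Ordinal (lt_bin i k).
have binD i k : (bin i k %/ f.+1)%N = i.
  by rewrite /= divnMDl // divn_small ?addn0 // ltn_ord.
have binM i k : (bin i k %% f.+1)%N = k by rewrite /= modnMDl modn_small.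
pose p := [ffun i : 'I_n => bin i ord0].
pose s := [ffun i : 'I_n => [set bin i (lift ord0 k) | k : 'I_f]].
have pD i : (p i %/ f.+1)%N = i by rewrite ffunE binD.
have sD i b : b \in s i -> (b %/ f.+1)%N = i.
  by rewrite ffunE => /imsetP[k _ ->]; rewrite binD.
have ps i : p i \notin s i.
  rewrite !ffunE; apply/imsetP => -[k _ /(congr1 (fun b : 'I_m => b %% f.+1)%N)].
  by rewrite !binM.
have cards i : #|s i| = f.
  rewrite ffunE card_imset ?card_ord // => k l.
  move=> /(congr1 (fun b : 'I_m => b %% f.+1)%N); rewrite !binM => /val_inj.
  exact: lift_inj.
have xP (i : 'I_n) : 0 < xs`_i <= 1 by apply: hxs; rewrite mem_nth.
have xeta (i : 'I_n) : 0 <= xs`_i / eta <= xs`_i.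
  have /andP[x0 _] := xP i; have e0 : 0 < eta by exact: lt_trans eta1.
  by rewrite divr_ge0 ?(ltW x0) ?(ltW e0) //= ler_pdivrMr // ler_peMr // ltW.
have sum_le1 (b : 'I_m) (a : 'I_n -> R) :
    (forall i : 'I_n, (b %/ f.+1)%N <> i -> a i = 0) -> (forall i, a i <= 1) ->
    \sum_i a i <= 1.
  move=> a0 a1; have hb : (b %/ f.+1 < n)%N by rewrite ltn_divLR // ltn_ord.
  rewrite (bigD1 (Ordinal hb)) //= big1 ?addr0 // => i /eqP ni.
  by apply: a0 => e; apply: ni; apply: val_inj.
have le1 (F : {set 'I_m}) (c : {ffun 'I_n -> 'I_m}) b :
    (forall i, p i \in F -> c i \in s i) ->
    bin_load p s b + promoted_load p F c b <= 1.
  move=> hc; rewrite /bin_load /promoted_load.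
  rewrite [X in X + _ + _]big_mkcond [X in _ + X + _]big_mkcond.
  rewrite [X in _ + X]big_mkcond /= -!big_split /=; apply: (sum_le1 b) => i.
    move=> ni; case: eqP => [e|_]; first by rewrite -e pD in ni.
    case: ifP => [/sD //|_]; case: ifP => [/andP[/hc + /eqP e]|]; last by rewrite !addr0.
    by rewrite e => /sD.
  have /andP[x0 x1] := xP i; have /andP[y0 yx] := xeta i.
  case: eqP => [e|_].
    rewrite -{1}e (negbTE (ps i)); case: ifP => [/andP[/hc + /eqP e']|_]; last by lra.
    by rewrite e' -e (negbTE (ps i)).
  by case: ifP => _; case: ifP => _; lra.
apply/existsP; exists p; apply/existsP; exists s; apply/and3P; split.
- by apply/forallP => i; rewrite cards eqxx ps.
- apply/forallP => b; have := @le1 set0 p b.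
  rewrite /promoted_load big1 ?addr0; first by apply=> i; rewrite inE.
  by move=> i; rewrite inE.
- apply/forallP => F; apply/implyP => hF.
  apply/existsP; exists [ffun i => odflt (p i) [pick b in s i :\: F]].
  have hc i : p i \in F -> odflt (p i) [pick b in s i :\: F] \in s i :\: F.
    move=> piF; case: pickP => //= h.
    have /subset_leq_card : p i |: s i \subset F.
      apply/subsetP => b; rewrite !inE => /orP[/eqP -> //|bs].
      by have := h b; rewrite !inE bs andbT => /negbFE.
    by rewrite cardsU1 ps cards add1n => /leq_trans/(_ hF); rewrite ltnn.
  apply/andP; split.
    apply/forallP => i; apply/implyP => /hc/setDP[cs cF].
    by rewrite ffunE; apply/andP.
  apply/forallP => b; apply/implyP => _; apply: le1 => i /hc/setDP[cs _].
  by rewrite ffunE.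
Qed.

Lemma Opt_subproof (xs : seq R) :
  exists m, (1 < eta) && all valid_size xs ==> packable xs m.
Proof.
exists (size xs * f.+1)%N; apply/implyP => /andP[eta1 hxs].
exact: packable_spread.
Qed.

(* The least m such that [xs] can be packed into m bins.  The guard
   only serves to make [Opt] total; see [OptP]. *)
Definition Opt (xs : seq R) : nat := ex_minn (Opt_subproof xs).

Lemma OptP (xs : seq R) : 1 < eta -> all valid_size xs ->
  packable xs (Opt xs) /\ forall m, packable xs m -> (Opt xs <= m)%N.
Proof.
move=> eta1 hxs; rewrite /Opt; case: ex_minnP => m.
by rewrite eta1 hxs /= => hm hmin; split.
Qed.

End OfflinePacking.

Section HarmonicStretch.
Variables (R : realType) (f : nat) (eta : R).

(* [Failures F]: from now on, the failed bins are exactly those of [F]. *)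
Inductive event := Arrival of R | Failures of seq nat.

Definition items (evs : seq event) : seq R :=
  pmap (fun e => if e is Arrival x then Some x else None) evs.

Definition valid_event (e : event) : bool :=
  match e with
  | Arrival x => valid_size x
  | Failures F => (size (undup F) <= f)%N
  end.

Definition top_class : nat := Num.truncn (6 * eta).

Definition primary_class (x : R) (i : nat) : bool :=
  [|| (1 <= i <= 5)%N && ((i.+1%:R)^-1 < x <= (i%:R)^-1),
      (i == 6)%N && ((7 - eta^-1)^-1 < x <= 6^-1) |
      (i == 7)%N && (x <= (7 - eta^-1)^-1)].

Definition standby_class (y : R) (j : nat) : bool :=
  [|| (1 <= j <= top_class.-1)%N &&
        ((j%:R + eta)^-1 < y <= (j%:R + eta - 1)^-1),
      (j == top_class)%N &&
        ((7 * eta - 1)^-1 < y <= (top_class%:R + eta - 1)^-1) |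
      (j == top_class.+1)%N && (y <= (7 * eta - 1)^-1)].

Definition item_class (x : R) (c : nat * nat) : bool :=
  primary_class x c.1 && standby_class (x / eta) c.2.

Definition small (c : nat * nat) : bool := (c.1 == 7)%N.

(* Bins are named by natural numbers.
   [g_prim]: for a regular group, B_0, ..., B_{j-1}; for a group of small items,
     the committed primary bin, if any (at most one element).
   [g_stby]: for a regular group, the f * i standby bins, beta^k_z being entry
     z * f + (k - 1); for a group of small items, its f mirroring bins.
   [g_count]: the number of items of a regular group (unused for small items).
   [g_srs]: for a group of small items, its super-replicas, latest first: the
     bin of the primary SR and the total size of its items.  In an incomplete
     group the first entry is the open SR.  The corresponding standby SRs lie in
     the mirroring bins and have total size 1/eta times that of the primary SR. *)
Record group := Group {
  g_class : nat * nat;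
  g_prim : seq nat;
  g_stby : seq nat;
  g_count : nat;
  g_srs : seq (nat * R);
  g_complete : bool }.

Record placement := Placement {
  pl_size : R;
  pl_prim : nat;
  pl_stby : seq nat }.

(* [small_prim]: the primary bins opened for small items.
   [active c]: the position in [groups] of the active group of class [c];
     [None] only before the first arrival of an item of class [c]. *)
Record state := State {
  failed : seq nat;
  opened : seq nat;
  small_prim : seq nat;
  groups : seq group;
  active : nat * nat -> option nat;
  placed : seq placement }.

Definition init : state := State [::] [::] [::] [::] (fun=> None) [::].

Definition group0 : group := Group (0, 0)%N [::] [::] 0 [::] true.
Definition get_group (st : state) (k : nat) : group := nth group0 (groups st) k.

Definition set_failed (st : state) (F : seq nat) : state :=
  State F (opened st) (small_prim st) (groups st) (active st) (placed st).

Definition set_group (st : state) (k : nat) (g : group) : state :=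
  State (failed st) (opened st) (small_prim st)
    (set_nth group0 (groups st) k g) (active st) (placed st).

Definition set_active (st : state) (c : nat * nat) (k : nat) : state :=
  State (failed st) (opened st) (small_prim st) (groups st)
    (fun c' => if c' == c then Some k else active st c') (placed st).

Definition add_group (st : state) (g : group) : state :=
  State (failed st) (g_prim g ++ g_stby g ++ opened st) (small_prim st)
    (rcons (groups st) g) (active st) (placed st).

Definition add_small_prim (st : state) (b : nat) : state :=
  State (failed st) (b :: opened st) (b :: small_prim st) (groups st)
    (active st) (placed st).

Definition add_placement (st : state) (pl : placement) : state :=
  State (failed st) (opened st) (small_prim st) (groups st) (active st)
    (pl :: placed st).

(* Load of a bin with every replica in the role it was placed in: promotions
   use the reserved space and do not influence where items are packed. *)
Definition load (st : state) (b : nat) : R :=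
  \sum_(pl <- placed st | pl_prim pl == b) pl_size pl +
  \sum_(pl <- placed st | b \in pl_stby pl) pl_size pl / eta.

Definition available (st : state) (g : group) : bool :=
  all (fun b => b \notin failed st) (g_prim g ++ g_stby g).

Definition fresh (st : state) (bs : seq nat) : bool :=
  uniq bs && all (fun b => (b \notin opened st) && (b \notin failed st)) bs.

Definition group_size (c : nat * nat) : nat :=
  if small c then f else (c.2 + f * c.1)%N.

Definition new_group (c : nat * nat) (bs : seq nat) : group :=
  if small c then Group c [::] bs 0 [::] false
  else Group c (take c.2 bs) (drop c.2 bs) 0 [::] false.

Definition candidate (st : state) (c : nat * nat) (g : group) : bool :=
  [&& g_class g == c, ~~ g_complete g & available st g].

(* Selection of a new active group for class [c]. *)
Inductive select (st : state) (c : nat * nat) : state -> Prop :=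
| select_existing k :
    (k < size (groups st))%N -> candidate st c (get_group st k) ->
    select st c (set_active st c k)
| select_fresh bs :
    ~~ has (candidate st c) (groups st) ->
    size bs = group_size c -> fresh st bs ->
    select st c (set_active (add_group st (new_group c bs)) c (size (groups st))).

(* The t-th item goes to spot z of B_w and to spot w of beta^1_z, ..., beta^f_z,
   where w = t %% j and z = t %/ j; no spot is thus used twice in a group. *)
Definition put_regular (st : state) (k : nat) (x : R) : state :=
  let g := get_group st k in
  let: (i, j) := g_class g in
  let w := (g_count g %% j)%N in
  let z := (g_count g %/ j)%N in
  add_placement
    (set_group st k
       (Group (g_class g) (g_prim g) (g_stby g) (g_count g).+1 (g_srs g)
          ((g_count g).+1 == i * j)%N))
    (Placement x (nth 0%N (g_prim g) w) (take f (drop (z * f) (g_stby g)))).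

Inductive pack_regular (st : state) (c : nat * nat) (x : R) : state -> Prop :=
| pack_regular_continue k :
    active st c = Some k -> ~~ g_complete (get_group (put_regular st k x) k) ->
    pack_regular st c x (put_regular st k x)
| pack_regular_complete k st' :
    active st c = Some k -> g_complete (get_group (put_regular st k x) k) ->
    select (put_regular st k x) c st' ->
    pack_regular st c x st'.

Definition sr_capacity : R := 2 / (7 - eta^-1).
Definition standby_sr_capacity : R := 2 / (7 * eta - 1).

Definition fits_open (g : group) (x : R) : bool :=
  if g_srs g is (_, v) :: _ then
    (v + x <= sr_capacity) && ((v + x) / eta <= standby_sr_capacity)
  else false.

Definition put_open (st : state) (k : nat) (x : R) : state :=
  let g := get_group st k in
  if g_srs g is (b, v) :: srs then
    add_placement
      (set_group st k
         (Group (g_class g) (g_prim g) (g_stby g) (g_count g)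
            ((b, v + x) :: srs) (g_complete g)))
      (Placement x b (g_stby g))
  else st.

Definition mirrors_have_space (st : state) (g : group) : bool :=
  all (fun b => 2 * eta / (7 * eta - 1) <= 1 - load st b) (g_stby g).

Definition release (st : state) (k : nat) (complete : bool) : state :=
  let g := get_group st k in
  set_group st k
    (Group (g_class g) [::] (g_stby g) (g_count g) (g_srs g) complete).

Definition committed (st : state) (b : nat) : bool :=
  has (fun g => small (g_class g) && (b \in g_prim g)) (groups st).

Definition reusable (st : state) (g : group) (b : nat) : bool :=
  [&& b \in small_prim st, ~~ committed st b, b \notin failed st,
      sr_capacity <= 1 - load st b &
      b \notin [seq sr.1 | sr <- g_srs g]].

Definition put_new_sr (st : state) (k : nat) (b : nat) (x : R) : state :=
  let g := get_group st k in
  add_placement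
    (set_group st k
       (Group (g_class g) [:: b] (g_stby g) (g_count g) ((b, x) :: g_srs g)
          (g_complete g)))
    (Placement x b (g_stby g)).

Inductive open_sr (st : state) (k : nat) (x : R) : state -> Prop :=
| open_sr_reuse b :
    reusable st (get_group st k) b ->
    open_sr st k x (put_new_sr st k b x)
| open_sr_new b :
    ~~ has (reusable st (get_group st k)) (small_prim st) ->
    fresh st [:: b] ->
    open_sr st k x (put_new_sr (add_small_prim st b) k b x).

Inductive pack_small (c : nat * nat) (x : R) : state -> state -> Prop :=
| pack_small_open st k :
    active st c = Some k -> fits_open (get_group st k) x ->
    pack_small c x st (put_open st k x)
| pack_small_new_sr st k st' :
    active st c = Some k -> ~~ fits_open (get_group st k) x ->
    mirrors_have_space st (get_group st k) ->
    open_sr (release st k false) k x st' ->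
    pack_small c x st st'
| pack_small_complete st k st1 st' :
    active st c = Some k -> ~~ fits_open (get_group st k) x ->
    ~~ mirrors_have_space st (get_group st k) ->
    select (release st k true) c st1 ->
    pack_small c x st1 st' ->
    pack_small c x st st'.

(* The first group of a class is opened when its first item arrives. *)
Definition activate (st : state) (c : nat * nat) (st' : state) : Prop :=
  if active st c is Some _ then st' = st else select st c st'.

Definition arrive (st : state) (x : R) (st' : state) : Prop :=
  exists c st1, [/\ item_class x c, activate st c st1 &
    if small c then pack_small c x st1 st' else pack_regular st1 c x st'].

Definition broken (st : state) (c : nat * nat) : bool :=
  if active st c is Some k then ~~ available st (get_group st k) else false.

(* Every active group hit by a failure is replaced, in any order. *)
Inductive reselect : state -> state -> Prop :=
| reselect_done st : (forall c, ~~ broken st c) -> reselect st st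
| reselect_step st c st1 st' :
    broken st c -> select st c st1 -> reselect st1 st' -> reselect st st'.

Definition step (st : state) (e : event) (st' : state) : Prop :=
  match e with
  | Arrival x => arrive st x st'
  | Failures F => reselect (set_failed st F) st'
  end.

Fixpoint run (st : state) (evs : seq event) (st' : state) : Prop :=
  if evs is e :: evs' then exists2 st1, step st e st1 & run st1 evs' st'
  else st' = st.

Definition bins_opened (st : state) : nat := size (opened st).

End HarmonicStretch.

(* Main.v *)
(* A replica is charged its share of a full group of its class (or, when small,
   the density of a full bin), so that every full bin costs the algorithm one
   unit of weight.  The groups have disjoint bins, so at most f incomplete
   groups of a class are hit by failures, and a fresh one is opened only if all
   of them are: boundedly many groups are incomplete, and likewise boundedly
   many primary bins of small items have room for another super-replica.
   In an optimal packing every bin b has weight at most 7/4.  If the primary bin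
   of an item and all its other standby bins fail, b must host the promoted
   standby; hence the total size in b plus (eta - 1) times the largest standby
   size y is at most 1.  Primaries have density at most 3/2, except for at most
   one of weight 1 and size above 1/2, so they exceed this density by at most
   1/4.  With z = eta * y, there are three cases.  If z <= 1/3, standbys have
   density at most 3/2 too.  If z > 1/3 and the largest standby has weight at
   most 1/2, the others have density at most 1 / (1 - z) >= 3/2, and together
   with the primaries they fill a space of at most 1 - z.  If the largest has
   weight 1, then this space is below 1 / (1 + eta) < 1/2, and everything in it
   has density at most 1 + eta / 2. *)
Require Import Defs.
From mathcomp Require Import all_boot all_order all_algebra.
From mathcomp Require Import reals.
From mathcomp Require Import lra ring zify.
Set Implicit Arguments.
Unset Strict Implicit.
Unset Printing Implicit Defensive.
Import Order.TTheory GRing.Theory Num.Theory.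
Local Open Scope ring_scope.

(** * Weights of replicas and their densities *)

Section Weights.
Variables (R : realType) (f : nat) (eta : R).
Hypothesis eta_gt1 : 1 < eta.

(* The inverse of 1 - sr_capacity, the load above which a primary bin of small
   items has no room for another super-replica; mirroring bins have the same. *)
Definition density : R := (7 - eta^-1) / (5 - eta^-1).
(* For regular items the truncations are the class i, resp. the class j minus 1. *)
Definition prim_weight (x : R) : R :=
  if x <= (7 - eta^-1)^-1 then density * x else (Num.truncn x^-1)%:R^-1.
Definition stby_weight (y : R) : R :=
  if y <= (7 * eta - 1)^-1 then density * y
  else (Num.truncn (y^-1 - eta)).+1%:R^-1.
Definition weight (x : R) : R := prim_weight x + f%:R * stby_weight (x / eta).

Lemma inv_eta : 0 < eta^-1 < 1.
Proof.
by rewrite invr_gt0 (lt_trans _ eta_gt1) //= invf_lt1 // (lt_trans _ eta_gt1).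
Qed.

Lemma eta_gt0 : 0 < eta.
Proof. exact: lt_trans eta_gt1. Qed.

Lemma density_bounds : 1 <= density <= 3 / 2.
Proof.
have /andP[h0 h1] := inv_eta.
by rewrite /density ler_pdivlMr ?ler_pdivrMr; lra.
Qed.

(** The two thresholds differ exactly by the factor [eta], so both parts of [weight] treat the same
    items as small. *)
Lemma small_stby_le (x : R) :
  (x / eta <= (7 * eta - 1)^-1) = (x <= (7 - eta^-1)^-1).
Proof.
have h := eta_gt0; rewrite ler_pdivrMr //.
suff -> : (7 * eta - 1)^-1 * eta = (7 - eta^-1)^-1 by [].
have -> : 7 - eta^-1 = (7 * eta - 1) / eta by field; rewrite gt_eqF.
by rewrite invfM invrK.
Qed.

Lemma prim_weight_regular (x : R) : x <= 1 -> (7 - eta^-1)^-1 < x ->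
  exists i : nat, [/\ (0 < i)%N, prim_weight x = i%:R^-1, i%:R * x <= 1 &
    1 < i.+1%:R * x].
Proof.
have /andP[h0 h1] := inv_eta.
move=> x1 hx; have x0 : 0 < x by apply: lt_trans hx; rewrite invr_gt0; lra.
have xi1 : 1 <= x^-1 by rewrite invf_ge1.
exists (Num.truncn x^-1); rewrite truncn_gt0 xi1 /prim_weight leNgt hx; split=> //.
  by rewrite -ler_pdivlMr // div1r truncn_le; lra.
by rewrite -ltr_pdivrMr // div1r truncnS_gt.
Qed.

Lemma stby_weight_regular (x : R) : x <= 1 -> (7 - eta^-1)^-1 < x ->
  exists j : nat, [/\ (0 < j)%N, stby_weight (x / eta) = j%:R^-1,
    1 < (j%:R + eta) * (x / eta) & (j%:R - 1 + eta) * (x / eta) <= 1].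
Proof.
have /andP[h0 h1] := inv_eta; have he := eta_gt0.
move=> x1 hx; have x0 : 0 < x by apply: lt_trans hx; rewrite invr_gt0; lra.
have y0 : 0 < x / eta by rewrite divr_gt0.
(* As [x <= 1], the truncated number is nonnegative, so the truncation is a genuine floor and not
   the default value 0. *)
have z0 : 0 <= (x / eta)^-1 - eta.
  by rewrite subr_ge0 invf_div ler_pdivlMr // ler_piMr // ltW.
exists (Num.truncn ((x / eta)^-1 - eta)).+1.
rewrite /stby_weight small_stby_le leNgt hx; split=> //.
  by rewrite -ltr_pdivrMr // div1r -ltrBlDr truncnS_gt.
by rewrite -ler_pdivlMr // div1r -lerBrDr -natr1 addrK truncn_le.
Qed.

(** A regular replica of weight [1 / i] has density below [(i + 1) / i], which is at most 3/2 for
    [i >= 2]; a size of at most 1/2 excludes [i = 1]. Small replicas have density at most 3/2 by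
    [density_bounds]. *)
Lemma prim_weight_bounds (x : R) : 0 < x <= 1 ->
  0 <= prim_weight x <= 1 /\ (x <= 1 / 2 -> prim_weight x <= 3 / 2 * x).
Proof.
have /andP[d1 d2] := density_bounds; have /andP[h0 h1] := inv_eta.
move=> /andP[x0 x1]; case: (leP x (7 - eta^-1)^-1) => hx.
  rewrite /prim_weight hx.
  have : x <= 1 / 6.
    by apply: le_trans hx _; rewrite div1r lef_pV2 ?posrE; lra.
  by split; [apply/andP; split; nra | move=> _; nra].
have [i [i0 -> hi1 hi2]] := prim_weight_regular x1 hx.
have iR : 0 < i%:R :> R by rewrite ltr0n.
split; first by rewrite invr_ge0 ler0n invf_le1 // ler1n.
move=> x12; have i2 : 2 <= i%:R :> R.
  case: i {iR hi1} i0 hi2 => [//|[|i]] _; first by move=> h; lra.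
  by rewrite ler_nat.
rewrite -div1r ler_pdivrMr //.
by move: hi2; rewrite -natr1; nra.
Qed.

(** For a regular item [1 < (j + eta) * (x / eta) = j * (x / eta) + x], which gives the first
    alternative; the second one is for small items. *)
Lemma stby_weight_le (x : R) : 0 < x <= 1 ->
  stby_weight (x / eta) * (1 - x) <= x / eta \/
  stby_weight (x / eta) <= 3 / 2 * (x / eta).
Proof.
have /andP[d1 d2] := density_bounds; have he := eta_gt0.
move=> /andP[x0 x1]; have y0 : 0 < x / eta by rewrite divr_gt0.
case: (leP x (7 - eta^-1)^-1) => hx.
  by right; rewrite /stby_weight small_stby_le hx; nra.
left; have [j [j0 -> hj _]] := stby_weight_regular x1 hx.
have jR : 0 < j%:R :> R by rewrite ltr0n.
rewrite mulrC ler_pdivrMr //.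
have -> : x = x / eta * eta by rewrite divfK // gt_eqF.
by rewrite mulfK ?gt_eqF //; nra.
Qed.

(** * The weight of one bin, where [P] and [S] are the items with a primary and a standby replica in
    it *)

Section Bin.
Variables (I : finType) (P S : {pred I}) (x : I -> R).
Hypothesis x01 : forall i, 0 < x i <= 1.

(** At most one primary is larger than 1/2, and its weight 1 exceeds 3/2 of its size by less than
    1/4. The second alternative records the load above 1/2, since it conflicts with a standby of
    weight 1. *)
Lemma prim_bin_weight : \sum_(i in P) x i <= 1 ->
  \sum_(i in P) prim_weight (x i) <= 3 / 2 * (\sum_(i in P) x i) \/
  1 / 2 < \sum_(i in P) x i /\
    \sum_(i in P) prim_weight (x i) <= 1 / 4 + 3 / 2 * (\sum_(i in P) x i).
Proof.
move=> L1; have [/existsP[k /andP[kP hk]]|] := boolP [exists i in P, 1 / 2 < x i].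
  right; move: L1; rewrite !(bigD1 k kP) /=.
  set L := \sum_(i in P | i != k) x i => L1.
  have L0 : 0 <= L by apply: sumr_ge0 => i _; have /andP[/ltW] := x01 i.
  have wk : prim_weight (x k) <= 1 by have [/andP[]] := prim_weight_bounds (x01 k).
  have : \sum_(i in P | i != k) prim_weight (x i) <= 3 / 2 * L.
    rewrite /L mulr_sumr; apply: ler_sum => i /andP[iP ik].
    have [_] := prim_weight_bounds (x01 i); apply.
    have : x i <= L.
      rewrite /L (bigD1 i) /=; last by rewrite iP.
      by rewrite lerDl sumr_ge0 // => i' _; have /andP[/ltW] := x01 i'.
    lra.
  by split; lra.
rewrite negb_exists_in => /forall_inP h; left.
rewrite mulr_sumr; apply: ler_sum => i iP.
by have [_] := prim_weight_bounds (x01 i); apply; rewrite leNgt h.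
Qed.

(** The only trace of fault tolerance in the bin: any one of its standbys may have to be
    promoted. *)
Hypothesis reserve : forall k, k \in S ->
  \sum_(i in P) x i + \sum_(i in S) x i / eta + (x k - x k / eta) <= 1.

Lemma bin_weight : \sum_(i in P) x i <= 1 ->
  \sum_(i in P) prim_weight (x i) + \sum_(i in S) stby_weight (x i / eta)
    <= 7 / 4.
Proof.
move=> L1; have hP := prim_bin_weight L1.
have /andP[d1 d2] := density_bounds; have he := eta_gt0.
have /andP[h0 h1] := inv_eta.
have L0 : 0 <= \sum_(i in P) x i by apply: sumr_ge0 => i _; have /andP[/ltW] := x01 i.
(* Without standbys the weight is at most [1 / 4 + 3 / 2]. *)
have [k0 k0S|S0] := pickP (mem S); last first.
  rewrite [X in _ + X]big_pred0 // addr0.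
  by case: hP => [|[]]; lra.
case: (Order.TotalTheory.arg_maxP x k0S) => k kS kmax {k0 k0S}.
have := reserve kS; rewrite !(bigD1 k kS) /=.
set L := \sum_(i in P) x i in L1 hP L0 *.
set T := \sum_(i in S | i != k) x i / eta.
have T0 : 0 <= T.
  by apply: sumr_ge0 => i _; have /andP[x0 _] := x01 i; rewrite divr_ge0 // ltW.
(* After its promotion the largest standby occupies its full size [x k] beside the primaries [L] and
   the other standbys [T]. *)
move=> hT; have {}hT : L + T + x k <= 1 by lra.
have /andP[xk0 xk1] := x01 k.
have yk : x k / eta <= x k by rewrite ler_pdivrMr // ler_peMr // ltW.
set W := \sum_(i in S | i != k) _.
have Wle a : (forall i, i \in S -> i != k ->
    stby_weight (x i / eta) <= a * (x i / eta)) -> W <= a * T.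
  by move=> h; rewrite /W /T mulr_sumr; apply: ler_sum => i /andP[]; apply: h.
(* Here [1 - x i >= 2 / 3] for every standby, so [stby_weight_le] yields density at most 3/2
   throughout. *)
have [x3|x3] := leP (x k) (1 / 3).
  have hw i : i \in S -> stby_weight (x i / eta) <= 3 / 2 * (x i / eta).
    move=> iS; have [hi|//] := stby_weight_le (x01 i).
    have /= xik := kmax i iS; have /andP[xi0 xi1] := x01 i.
    have y0 : 0 < x i / eta by rewrite divr_gt0.
    by nra.
  have := hw k kS; have := Wle (3 / 2) (fun i iS _ => hw i iS).
  by case: hP => [|[]]; lra.
have e1 := eta_gt1.
have hk : (7 - eta^-1)^-1 < x k.
  by apply: lt_trans x3; rewrite div1r ltf_pV2 ?posrE; lra.
have [j [j0 wj hj1 hj2]] := stby_weight_regular xk1 hk.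
have ek : x k / eta * eta = x k by rewrite divfK // gt_eqF.
rewrite wj; case: j j0 wj hj1 hj2 => [//|[|j]] _ wj hj1 hj2.
(* The case of weight 1: by this inequality [L + T] is below [1 / (1 + eta)]. *)
- have {}hj1 : eta < x k * (1 + eta).
    by move: hj1; rewrite mulrA ltr_pdivlMr // mul1r mulrC.
  have W1 : W <= (1 + eta / 2) * T.
    apply: Wle => i iS ik; have /andP[xi0 xi1] := x01 i.
    have y0 : 0 < x i / eta by rewrite divr_gt0.
    have [hi|hi] := leP (x i) (7 - eta^-1)^-1.
      rewrite /stby_weight small_stby_le hi; apply: ler_wpM2r; first exact: ltW.
      by lra.
    have [j' [j'0 -> hj' _]] := stby_weight_regular xi1 hi.
    have yT : x i / eta <= T.
      rewrite /T (bigD1 i) /= ?iS //.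
      rewrite lerDl sumr_ge0 // => i' _; have /andP[x0 _] := x01 i'.
      by rewrite divr_ge0 // ltW.
    (* A second standby of weight 1 would have size above [1 / (1 + eta)], hence above [T]. For
       [j' >= 2] the density is below [1 + eta / j']. *)
    case: j' j'0 hj' => [//|[|j']] _ hj'; first by nra.
    have j2 : 2 <= j'.+2%:R :> R by rewrite ler_nat.
    rewrite -div1r ler_pdivrMr; last by rewrite ltr0n.
    have : 0 <= x i / eta * eta * (j'.+2%:R - 2).
      by rewrite divfK ?gt_eqF // mulr_ge0; lra.
    by nra.
  have {}hP : \sum_(i in P) prim_weight (x i) <= (1 + eta / 2) * L.
    case: hP => [|[L2]]; first by nra.
    by nra.
  (* The product is at most [(2 + eta) / (2 * (1 + eta))], which is below 3/4 because [eta > 1]. *)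
  rewrite invr1; have : (1 + eta / 2) * (L + T) <= 3 / 4 by nra.
  lra.
- have j2 : (j.+2%:R)^-1 <= 1 / 2 :> R.
    by rewrite div1r lef_pV2 ?posrE ?ltr0n // ler_nat.
  have xk1' : x k < 1.
    have : 2 <= j.+2%:R :> R by rewrite ler_nat.
    have y0 : 0 < x k / eta by rewrite divr_gt0.
    by nra.
  have a0 : 0 < 1 - x k by lra.
  have W1 : W <= (1 - x k)^-1 * T.
    apply: Wle => i iS ik; have /andP[xi0 xi1] := x01 i.
    have y0 : 0 < x i / eta by rewrite divr_gt0.
    have /= xik := kmax i iS.
    rewrite [leRHS]mulrC ler_pdivlMr //.
    have w0 : 0 <= stby_weight (x i / eta).
      by rewrite /stby_weight; case: ifP => _; [nra | rewrite invr_ge0].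
    (* The first alternative is weakened by [x i <= x k], the second one by [1 - x k < 2 / 3]. *)
    by case: (stby_weight_le (x01 i)) => hi; nra.
  (* From [T <= 1 - x k - L]. Since the factor of [L] is at least 3/2, this loss offsets the density
     of the primaries, and [1 / 2 + 1 + 1 / 4] remains. *)
  have : W <= 1 - L * (1 - x k)^-1.
    apply: le_trans W1 _.
    have -> : 1 - L * (1 - x k)^-1 = (1 - x k)^-1 * (1 - x k - L).
      by field; rewrite gt_eqF.
    by apply: ler_wpM2l; [rewrite invr_ge0 ltW | lra].
  have : 3 / 2 <= (1 - x k)^-1.
    by rewrite -[leRHS]div1r ler_pdivlMr; lra.
  move: (1 - x k)^-1 => a ha hW.
  have : L * (3 / 2) <= L * a by rewrite ler_wpM2l.
  clear Wle W1; move: hP hW j2; rewrite /= -/W.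
  move: W (\sum_(i in P) prim_weight (x i)) (j.+2%:R)^-1 => w p q.
  by case=> [|[]]; lra.
Qed.

End Bin.

End Weights.

(** * Total weight as a lower bound for the optimum *)

Section Opt.
Variables (R : realType) (f : nat) (eta : R).
Hypothesis eta_gt1 : 1 < eta.

(* If the primary bin of [k] and all its standby bins except [b] fail, the
   replica of [k] in [b] must be promoted. *)
Lemma valid_packing_reserve (xs : seq R) m
    (p : {ffun 'I_(size xs) -> 'I_m}) (s : {ffun 'I_(size xs) -> {set 'I_m}}) b k :
  (forall i : 'I_(size xs), 0 < xs`_i <= 1) -> valid_packing f eta p s ->
  b \in s k -> bin_load eta p s b + (xs`_k - xs`_k / eta) <= 1.
Proof.
move=> x01 /and3P[/forallP hs _ /forallP hF] bk.
have /andP[/eqP cs ps] := hs k.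
pose F := p k |: (s k :\ b).
have cF : (#|F| <= f)%N.
  rewrite /F cardsU1 !inE (negbTE ps) andbF /= -cs (cardsD1 b (s k)) bk.
  by [].
have /existsP[c /andP[/forallP hc /forallP hl]] := implyP (hF F) cF.
have bF : b \notin F.
  by rewrite !inE eqxx /= orbF; apply: contraNneq ps => <-.
have /implyP/(_ (setU11 _ _))/andP[ck ckF] := hc k.
have cb : c k = b.
  by apply/eqP; move: ckF; rewrite !inE ck andbT => /norP[_ /negbNE].
apply: le_trans (implyP (hl b) bF); rewrite lerD2l /promoted_load.
rewrite (bigD1 k) /=; last by rewrite setU11 cb eqxx.
rewrite lerDl sumr_ge0 // => i _; have /andP[x0 _] := x01 i.
have eta0 := eta_gt0 eta_gt1.
by rewrite subr_ge0 ler_pdivrMr // ler_peMr // ltW.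
Qed.

(** Double counting: an item has one primary bin and exactly [f] standby bins, so the weights of the
    items and of the bins have the same sum; then [bin_weight] applies to each bin. *)
Lemma weight_le_Opt (xs : seq R) : all (@valid_size R) xs ->
  \sum_(x <- xs) weight f eta x <= 7 / 4 * (Opt f eta xs)%:R.
Proof.
move=> hxs; have [/existsP[p /existsP[s V]] _] := OptP f eta_gt1 hxs.
move: (Opt f eta xs) p s V => m p s V.
have x01 (i : 'I_(size xs)) : 0 < xs`_i <= 1 by apply: (allP hxs); rewrite mem_nth.
have /and3P[/forallP hs /forallP hb _] := V.
rewrite (big_nth 0) big_mkord big_split /=.
have -> : \sum_(i < size xs) prim_weight eta xs`_i =
    \sum_(b < m) \sum_(i | p i == b) prim_weight eta xs`_i.
  by rewrite (partition_big p xpredT).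
have -> : \sum_(i < size xs) f%:R * stby_weight eta (xs`_i / eta) =
    \sum_(b < m) \sum_(i | b \in s i) stby_weight eta (xs`_i / eta).
  rewrite [RHS](exchange_big_dep xpredT) //=; apply: eq_bigr => i _.
  have /andP[/eqP <- _] := hs i.
  by rewrite sumr_const mulr_natl.
rewrite -big_split /=.
have -> : 7 / 4 * m%:R = \sum_(b < m) (7 / 4 : R).
  by rewrite sumr_const card_ord mulr_natr.
apply: ler_sum => b _.
have := @bin_weight R eta eta_gt1 _ [pred i | p i == b] [pred i | b \in s i]
  (fun i : 'I_(size xs) => xs`_i) x01.
apply.
  by move=> k bk; apply: valid_packing_reserve.
apply: le_trans (hb b); rewrite /bin_load lerDl sumr_ge0 // => i _.
have /andP[x0 _] := x01 i; rewrite divr_ge0 ?ltW //; exact: eta_gt0.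
Qed.

End Opt.

(** * Weights in terms of the classes used by the algorithm *)

Section Classes.
Variables (R : realType) (f : nat) (eta : R).
Hypothesis eta_gt1 : 1 < eta.

Definition valid_class (c : nat * nat) : bool :=
  [&& 0 < c.1 <= 7, 0 < c.2 & c.2 <= (top_class eta).+1]%N.

(** The weight of a small item, all replicas included, per unit of its primary size. *)
Definition small_rate : R := density eta + f%:R * (density eta / eta).

Lemma item_class_valid (x : R) c : item_class eta x c -> valid_class c.
Proof.
have top6 : (0 < top_class eta)%N.
  by have e1 := eta_gt1; rewrite /top_class truncn_gt0; lra.
case: c => i j /andP[/=]; rewrite /valid_class /=.
move=> /or3P[/andP[hi _]|/andP[/eqP -> _]|/andP[/eqP -> _]];
  move=> /or3P[/andP[hj _]|/andP[/eqP -> _]|/andP[/eqP -> _]]; lia.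
Qed.

Lemma item_class_small (x : R) c : item_class eta x c ->
  small c -> x <= (7 - eta^-1)^-1.
Proof.
case: c => i j /andP[/= + _] /eqP /= i7; rewrite i7.
by case/or3P => /andP[].
Qed.

Lemma small_weight (x : R) c : item_class eta x c -> small c ->
  weight f eta x = small_rate * x.
Proof.
move=> hx /(item_class_small hx) xs; rewrite /weight /prim_weight xs.
by rewrite /stby_weight small_stby_le // xs /small_rate; ring.
Qed.

Lemma prim_weight_class (x : R) n : (0 < n)%N -> (7 - eta^-1)^-1 < x ->
  n.+1%:R^-1 < x -> x <= n%:R^-1 -> prim_weight eta x = n%:R^-1.
Proof.
move=> n0 hs l r; rewrite /prim_weight leNgt hs /=; congr (_%:R^-1).
have x0 : 0 < x by apply: lt_trans l; rewrite invr_gt0 ltr0n.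
apply: truncn_def; rewrite -[x^-1]div1r ler_pdivlMr // ltr_pdivrMr //.
move: l r; rewrite -[n.+1%:R^-1]div1r -[n%:R^-1]div1r ler_pdivlMr ?ltr0n //.
by rewrite ltr_pdivrMr ?ltr0n // ![x * _]mulrC => -> ->.
Qed.

(** The number [1 / y - eta] lies between [n - 1] and [n], so its truncation is [n - 1]. Bounding
    [y^-1] rather than naming the class interval lets the truncated top class fit as well. *)
Lemma stby_weight_class (y : R) n : (0 < n)%N -> 0 < y ->
  (7 * eta - 1)^-1 < y -> y^-1 < n%:R + eta -> y <= (n%:R + eta - 1)^-1 ->
  stby_weight eta y = n%:R^-1.
Proof.
move=> n0 y0 hs l r; rewrite /stby_weight leNgt hs /=.
suff -> : Num.truncn (y^-1 - eta) = n.-1 by rewrite prednK.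
have e1 := eta_gt1; have n1 : 1 <= n%:R :> R by rewrite ler1n.
have np : n.-1%:R = n%:R - 1 :> R by rewrite -subn1 natrB.
apply: truncn_def; rewrite prednK // np; apply/andP; split; last by lra.
have : n%:R + eta - 1 <= y^-1.
  by rewrite -[n%:R + eta - 1]invrK lef_pV2 ?posrE ?invr_gt0 //; lra.
by lra.
Qed.

(** Consequently the [i * j] items of a full group weigh [j + f * i], which is its number of
    bins. *)
Lemma item_class_regular (x : R) c : 0 < x -> item_class eta x c -> ~~ small c ->
  weight f eta x = c.1%:R^-1 + f%:R * c.2%:R^-1.
Proof.
have /andP[h0 h1] := inv_eta eta_gt1; have e0 := eta_gt0 eta_gt1.
have e1 := eta_gt1.
case: c => i j x0 /andP[/= + +]; rewrite /small /= => hx hy i7.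
have hs : (7 - eta^-1)^-1 < x.
  case/or3P: hx => [/andP[/andP[i0 i5] /andP[l _]]|/andP[_ /andP[]//]|/andP[/eqP i7' _]].
    apply: le_lt_trans l; rewrite lef_pV2 ?posrE ?ltr0n //; last by lra.
    have : i.+1%:R <= 6 :> R by rewrite ler_nat.
    by lra.
  by rewrite i7' in i7.
have hs' : (7 * eta - 1)^-1 < x / eta by rewrite ltNge small_stby_le // -ltNge.
have y0 : 0 < x / eta by rewrite divr_gt0.
rewrite /weight; congr (_ + _ * _).
  case/or3P: hx => [/andP[/andP[i0 _] /andP[]]|/andP[/eqP -> /andP[_ r]]|/andP[/eqP i7' _]].
  - exact: prim_weight_class.
  - by apply: prim_weight_class => //; apply: le_lt_trans hs; rewrite lef_pV2 ?posrE; lra.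
  - by rewrite i7' in i7.
have ltV z : 0 < z -> z^-1 < x / eta -> (x / eta)^-1 < z.
  by move=> z0 h; rewrite -[z]invrK ltf_pV2 ?posrE ?invr_gt0.
have jeta n : 0 < n%:R + eta by apply: ltr_wpDl.
case/or3P: hy => [/andP[/andP[j0 _] /andP[l r]]|/andP[/eqP -> /andP[l r]]|/andP[_]].
- by apply: stby_weight_class => //; apply: ltV.
- have t0 : (0 < top_class eta)%N by rewrite /top_class truncn_gt0; lra.
  apply: stby_weight_class => //.
  (* From [6 * eta < top_class + 1] one gets [7 * eta - 1 < top_class + eta]. *)
  have := truncnS_gt (6 * eta); rewrite -/(top_class eta) -natr1 => ht.
  have : (x / eta)^-1 < 7 * eta - 1 by apply: ltV => //; lra.
  by lra.
- by rewrite leNgt hs'.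
Qed.

End Classes.

(** * The invariant of a run and its preservation by elementary changes of the state *)

Section Invariant.
Variables (R : realType) (f : nat) (eta : R).
Hypothesis eta_gt1 : 1 < eta.

Implicit Types (st : state R) (g : group R) (c : nat * nat) (b k : nat).

Definition bins g : seq nat := g_prim g ++ g_stby g.
Definition srs_total g : R := \sum_(sr <- g_srs g) sr.2.
(** The weight of the items packed into the group, recovered from what the group stores. *)
Definition credit g : R :=
  if small (g_class g) then small_rate f eta * srs_total g
  else (g_count g)%:R * ((g_class g).1%:R^-1 + f%:R * (g_class g).2%:R^-1).

(** The space condition of [reusable], detached from its other conditions. *)
Definition roomy st b : bool := load eta st b <= 1 - sr_capacity eta.

(** Both ranges start at 0, so this overcounts the valid classes. *)
Definition class_count : nat := (8 * (top_class eta).+2)%N.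
(* A roomy bin that cannot be reused is committed to an incomplete group, failed,
   or hosts one of the at most 7 * eta super-replicas of the active group. *)
Definition roomy_bound : nat :=
  (class_count * f.+1 + f + (Num.truncn (7 * eta)).+1)%N.

(** The boolean in the first clause is read as a number: an incomplete group commits at most one
    bin, a complete one none. The last clause of each branch lets complete groups pay for their
    bins. *)
Definition group_kind st g : Prop :=
  if small (g_class g) then
    [/\ (size (g_prim g) <= ~~ g_complete g)%N,
        size (g_stby g) = f,
        {in g_stby g, forall b, load eta st b = srs_total g / eta} &
        g_complete g -> 1 <= density eta * (srs_total g / eta)]
  else
    [/\ size (g_prim g) = (g_class g).2,
        {in g_prim g, forall b, b \notin small_prim st} &
        g_complete g -> g_count g = ((g_class g).1 * (g_class g).2)%N].

Record group_ok st g : Prop := GroupOk {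
  ok_class : valid_class eta (g_class g);
  ok_opened : {subset bins g <= opened st};
  ok_srs : {in g_srs g, forall sr, sr.1 \in small_prim st /\ 0 <= sr.2};
  ok_closed : all (fun sr => sr_capacity eta / 2 <= sr.2) (behead (g_srs g));
  ok_stby : {in g_stby g, forall b, b \notin small_prim st};
  ok_kind : group_kind st g }.

(** [xs] lists the items packed so far. [inv_sp_load] and [inv_credit] turn weight into payment for
    bins; [inv_incomplete] and [inv_roomy] limit the bins left unpaid. In [inv_size], committed bins
    are counted only through [small_prim]. *)
Record hs_inv st (xs : seq R) : Prop := Inv {
  inv_failed : (size (undup (failed st)) <= f)%N;
  inv_group k : (k < size (groups st))%N -> group_ok st (get_group st k);
  inv_disjoint k1 k2 b :
    b \in bins (get_group st k1) -> b \in bins (get_group st k2) -> k1 = k2;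
  inv_sp_opened : {subset small_prim st <= opened st};
  inv_sp_uniq : uniq (small_prim st);
  inv_unopened b : b \notin opened st -> load eta st b = 0;
  inv_placed : all (fun pl => 0 <= pl_size pl) (placed st);
  inv_sp_load : \sum_(b <- small_prim st) load eta st b
    <= \sum_(g <- groups st | small (g_class g)) srs_total g;
  inv_credit : \sum_(g <- groups st) credit g <= \sum_(x <- xs) weight f eta x;
  inv_size : size (opened st) =
    (\sum_(g <- groups st) group_size f (g_class g) + size (small_prim st))%N;
  inv_incomplete c :
    (count (fun g => (g_class g == c) && ~~ g_complete g) (groups st) <= f.+1)%N;
  inv_roomy : (count (roomy st) (small_prim st) <= roomy_bound)%N }.

(** A frame rule for a group that a transition leaves untouched: no opened bin may change its role,
    and mirroring bins must keep their load. *)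
Lemma group_ok_mono st st' g : group_ok st g ->
  {subset opened st <= opened st'} -> {subset small_prim st <= small_prim st'} ->
  {in opened st, small_prim st' =i small_prim st} ->
  (small (g_class g) ->
     {in g_stby g, forall b, load eta st' b = load eta st b}) ->
  group_ok st' g.
Proof.
move=> [cl op sr cs sb kd] hop hsp hin hl; split => //.
- by move=> b /op/hop.
- by move=> s /sr[/hsp].
- move=> b bg; rewrite hin; first exact: sb.
  by apply: op; rewrite mem_cat bg orbT.
- move: kd hl; rewrite /group_kind; case: ifP => _.
    move=> [h1 h2 h3 h4] /(_ isT) hl; split => // b bg.
    by rewrite hl // h3.
  move=> [h1 h2 h3] _; split => // b bg.
  by rewrite hin; [exact: h2 | apply: op; rewrite mem_cat bg].
Qed.

Lemma get_set_group st k g k' :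
  get_group (set_group st k g) k' = if k' == k then g else get_group st k'.
Proof. by rewrite /get_group nth_set_nth. Qed.

Lemma groups_set_group st k : (k < size (groups st))%N ->
  exists l r, groups st = l ++ get_group st k :: r /\
    forall g, groups (set_group st k g) = l ++ g :: r.
Proof.
move=> hk; exists (take k (groups st)), (drop k.+1 (groups st)); split.
  by rewrite -drop_nth // cat_take_drop.
by move=> g; rewrite /= set_nthE hk.
Qed.

Lemma size_set_group st k g : (k < size (groups st))%N ->
  size (groups (set_group st k g)) = size (groups st).
Proof. by move=> hk; rewrite size_set_nth; apply/maxn_idPr. Qed.

Lemma load_place st pl b : load eta (add_placement st pl) b =
  load eta st b + ((if pl_prim pl == b then pl_size pl else 0) +
    (if b \in pl_stby pl then pl_size pl / eta else 0)).
Proof.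
rewrite /load /= !big_cons /=.
case: ifP => _; case: ifP => _; ring.
Qed.

Lemma load_ge0 st b : all (fun pl => 0 <= pl_size pl) (placed st) ->
  0 <= load eta st b.
Proof.
move=> h; have e0 := ltW (eta_gt0 eta_gt1).
have {}h p : 0 <= \sum_(pl <- placed st | p pl) pl_size pl.
  rewrite big_mkcond; elim: (placed st) h => [|pl l IH] /=; first by rewrite big_nil.
  by move=> /andP[pl0 /IH]; rewrite big_cons; case: ifP => _ // ?; rewrite ?addr_ge0 ?add0r.
by rewrite addr_ge0 // -mulr_suml mulr_ge0 ?invr_ge0.
Qed.

Lemma group_bins_opened st xs k : hs_inv st xs ->
  {subset bins (get_group st k) <= opened st}.
Proof.
move=> I b; case: (ltnP k (size (groups st))) => hk.
  by apply: (ok_opened (inv_group I hk)).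
by rewrite /get_group nth_default.
Qed.

Lemma bins_in_range st k b :
  b \in bins (get_group st k) -> (k < size (groups st))%N.
Proof. by apply: contraTT; rewrite -leqNgt /get_group => /(nth_default _) ->. Qed.

Lemma inv_set_failed st xs F : hs_inv st xs -> (size (undup F) <= f)%N ->
  hs_inv (set_failed st F) xs.
Proof. by move=> [*]; split => //= *; apply: group_ok_mono; eauto. Qed.

Lemma inv_set_active st xs c k : hs_inv st xs -> hs_inv (set_active st c k) xs.
Proof. by move=> [*]; split => //= *; apply: group_ok_mono; eauto. Qed.

(* Unavailable groups are at most [f], since the groups have disjoint bins. *)
Lemma count_incomplete_unavailable st xs c : hs_inv st xs ->
  ~~ has (candidate st c) (groups st) ->
  (count (fun g => (g_class g == c) && ~~ g_complete g) (groups st) <= f)%N.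
Proof.
move=> I; rewrite -all_predC => /(all_nthP (group0 R)) hc.
pose P g := (g_class g == c) && ~~ g_complete g; rewrite -/P.
pose bad k := nth 0%N (bins (get_group st k))
  (find (fun b => b \in failed st) (bins (get_group st k))).
pose ks := [seq k <- iota 0 (size (groups st)) | P (get_group st k)].
have -> : count P (groups st) = size ks.
  rewrite size_filter -[in LHS](mkseq_nth (group0 R) (groups st)) count_map.
  by apply: eq_count.
have badP k : k \in ks -> bad k \in bins (get_group st k) /\ bad k \in failed st.
  rewrite mem_filter mem_iota add0n => /andP[Pk /= hk].
  have hf : has (fun b => b \in failed st) (bins (get_group st k)).
    have := hc k hk; rewrite /= /candidate -/(get_group st k) andbA -/(P _) Pk /=.
    rewrite /available -/(bins _) => /allPn[b bb]; rewrite negbK => bf.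
    by apply/hasP; exists b.
  by split; [rewrite mem_nth // -has_find | exact: nth_find].
have uks : uniq ks by rewrite filter_uniq ?iota_uniq.
rewrite -(size_map bad); apply: leq_trans (inv_failed I).
apply: uniq_leq_size.
  rewrite map_inj_in_uniq // => k1 k2 /badP[h1 _] /badP[h2 _] e.
  by apply: (inv_disjoint I h1); rewrite e.
by move=> _ /mapP[k /badP[_ h] ->]; rewrite mem_undup.
Qed.

Definition act_ok st c : Prop := forall k, active st c = Some k ->
  [/\ (k < size (groups st))%N, g_class (get_group st k) = c &
      ~~ g_complete (get_group st k)].

Lemma bins_new_group c bs : bins (new_group R c bs) = bs.
Proof. by rewrite /new_group /bins; case: ifP => //= _; rewrite cat_take_drop. Qed.

Lemma new_group_class c bs : g_class (new_group R c bs) = c.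
Proof. by rewrite /new_group; case: ifP. Qed.

Lemma new_group_complete c bs : g_complete (new_group R c bs) = false.
Proof. by rewrite /new_group; case: ifP. Qed.

Lemma get_add_group st g k : get_group (add_group st g) k =
  if k == size (groups st) then g else get_group st k.
Proof.
rewrite /get_group nth_rcons; case: (ltngtP k (size (groups st))) => // h.
by rewrite nth_default // ltnW.
Qed.

Lemma inv_add_group st xs c bs : hs_inv st xs -> valid_class eta c ->
  ~~ has (candidate st c) (groups st) -> size bs = group_size f c ->
  fresh st bs -> hs_inv (add_group st (new_group R c bs)) xs.
Proof.
move=> I vc hc sbs /andP[ubs /allP fbs].
have hin : (count (fun g => (g_class g == c) && ~~ g_complete g) (groups st) <= f)%N.
  exact: (count_incomplete_unavailable I hc).
have nop b : b \in bs -> b \notin opened st by move=> /fbs/andP[].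
have eop : opened (add_group st (new_group R c bs)) = bs ++ opened st.
  by rewrite /= catA -/(bins _) bins_new_group.
set g := new_group R c bs in eop *.
have srs0 : g_srs g = [::] by rewrite /g /new_group; case: ifP.
have tot0 : srs_total g = 0 by rewrite /srs_total srs0 big_nil.
have gc : g_class g = c by apply: new_group_class.
split; rewrite ?eop //.
- exact: (inv_failed I).
- rewrite size_rcons => k hk; rewrite get_add_group; case: eqP => [_|nk].
    split; rewrite ?srs0 ?gc //.
    + by move=> b; rewrite bins_new_group eop mem_cat => ->.
    + move=> b bg; apply/negP => /(inv_sp_opened I); apply/negP/nop.
      by rewrite -(bins_new_group c bs) mem_cat bg orbT.
    + rewrite /group_kind gc; case: ifP => sc; last first.
        rewrite /g /new_group sc /= size_takel ?sbs /group_size ?sc ?leq_addr //.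
        split => // b /mem_take /nop bb; apply: contra bb.
        exact: (inv_sp_opened I).
      have -> : g_stby g = bs by rewrite /g /new_group sc.
      rewrite tot0 mul0r /g /new_group sc sbs /group_size sc; split => // b /nop.
      exact: (inv_unopened I).
  have {}hk : (k < size (groups st))%N by lia.
  apply: (group_ok_mono (inv_group I hk) _ _ _ _) => // b.
  by rewrite eop mem_cat => ->; rewrite orbT.
- have nb k b : b \in bins (get_group st k) -> b \notin bs.
    by apply: contraTN => /nop; apply: contra; exact: (group_bins_opened I).
  move=> k1 k2 b; rewrite !get_add_group.
  case: eqP => [->|_]; case: eqP => [->|_] //.
  + by rewrite bins_new_group => bb /nb; rewrite bb.
  + by rewrite bins_new_group => /nb /negbTE ->.
  + by move=> h1 h2; apply: (inv_disjoint I h1 h2).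
- by move=> b /(inv_sp_opened I); rewrite mem_cat orbC => ->.
- exact: (inv_sp_uniq I).
- by move=> b; rewrite mem_cat => /norP[_]; apply: (inv_unopened I).
- exact: (inv_placed I).
- rewrite /= -cats1 big_cat /= big_cons big_nil tot0 addr0.
  by case: ifP => _; rewrite ?addr0; exact: (inv_sp_load I).
- rewrite /= -cats1 big_cat /= big_cons big_nil /credit gc tot0 !mulr0.
  have -> : g_count g = 0%N by rewrite /g /new_group; case: ifP.
  by rewrite mul0r if_same !addr0; exact: (inv_credit I).
- rewrite /= -cats1 big_cat /= big_cons big_nil gc size_cat sbs (inv_size I); lia.
(* At most [f] incomplete groups of class [c] existed, by [hin]; the new one makes [f + 1]. *)
- move=> c'; rewrite /= -cats1 count_cat /= gc new_group_complete andbT addn0.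
  case: eqP => [<-|_]; last by rewrite addn0; exact: (inv_incomplete I c').
  by rewrite addn1.
- exact: (inv_roomy I).
Qed.

(** Class [c] is exempted in the premise because its active group may just have become complete; the
    selection repairs this. *)
Lemma inv_select st xs c st' : hs_inv st xs -> valid_class eta c ->
  (forall c', c' != c -> act_ok st c') -> select f st c st' ->
  hs_inv st' xs /\ forall c', act_ok st' c'.
Proof.
move=> I vc A S; case: S => [k hk /and3P[/eqP kc kn _]|bs hc sbs fbs].
  split; first exact: inv_set_active.
  move=> c' k' /=; case: eqP => [-> [<-] //|/eqP ne]; exact: A.
split; first by apply/inv_set_active/inv_add_group.
move=> c' k'; rewrite /act_ok /= size_rcons.
have gE k'' : get_group (set_active (add_group st (new_group R c bs)) c (size (groups st))) k''
  = get_group (add_group st (new_group R c bs)) k'' by [].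
rewrite gE get_add_group; case: eqP => [-> [<-]|/eqP ne].
  by rewrite eqxx new_group_class new_group_complete.
move=> /(A c' ne)[h1 h2 h3]; split; [by lia| |];
  by case: eqP => [e|//]; rewrite e ltnn in h1.
Qed.

(** Common to all placements, where [g] is the updated group. A small item adds [x] to both sides of
    [inv_sp_load]; a regular one changes neither, as its bins lie outside [small_prim]. *)
Lemma inv_place st xs k g x b ss :
  let st' := add_placement (set_group st k g) (Placement x b ss) in
  let g0 := get_group st k in
  hs_inv st xs -> 0 <= x -> (k < size (groups st))%N ->
  g_class g = g_class g0 -> g_stby g = g_stby g0 -> ~~ g_complete g0 ->
  (forall k' b', k' != k -> b' \in g_prim g -> b' \notin bins (get_group st k')) ->
  {subset ss <= g_stby g0} ->
  b \in opened st ->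
  (if small (g_class g0) then srs_total g = srs_total g0 + x /\ b \in small_prim st
   else b \notin small_prim st /\ b \in g_prim g0) ->
  credit g = credit g0 + weight f eta x ->
  group_ok st' g ->
  hs_inv st' (x :: xs).
Proof.
move=> st' g0 I x0 hk cg sg ng hdis hss bo hb hcr gok.
have e0 := eta_gt0 eta_gt1.
have G0 : group_ok st g0 := inv_group I hk.
have getE k' : get_group st' k' = if k' == k then g else get_group st k'.
  exact: get_set_group.
have loadE b' : load eta st' b' = load eta st b' +
    ((if b == b' then x else 0) + (if b' \in ss then x / eta else 0)).
  exact: load_place.
have loadS b' : load eta st b' <= load eta st' b'.
  rewrite loadE lerDl; case: ifP => _; case: ifP => _;
    by rewrite ?addr_ge0 ?divr_ge0 ?addr0 // ltW.
have [l [r [gsE gsE']]] := groups_set_group hk.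
have ssP b' : b' \in ss -> b' \in bins g0.
  by move=> /hss h; rewrite mem_cat h orbT.
have spS b' : b' \in small_prim st -> b' \notin ss.
  by move=> hb'; apply/negP => /hss/(ok_stby G0); rewrite hb'.
split => //.
- exact: (inv_failed I).
- move=> k'; rewrite (size_set_group _ hk) => hk'; rewrite getE; case: eqP => // /eqP nk.
  apply: (group_ok_mono (inv_group I hk') _ _ _ _) => // sk b' hb'.
  have hb'' : b' \in bins (get_group st k') by rewrite mem_cat hb' orbT.
  rewrite loadE; case: eqP => [e|_].
    subst b'; case: ifP hb => [_ [_]|_ [_ hbg]].
      by move=> hbs; have := ok_stby (inv_group I hk') hb'; rewrite hbs.
    suff : k' = k by move=> e; rewrite e eqxx in nk.
    by apply: (inv_disjoint I hb''); rewrite mem_cat hbg.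
  case: ifP => [/ssP h|]; last by rewrite !addr0.
  by have := inv_disjoint I hb'' h => e; rewrite e eqxx in nk.
- have hg k' b' : k' != k -> b' \in bins g -> b' \notin bins (get_group st k').
    move=> nk; rewrite mem_cat => /orP[|]; first exact: hdis.
    rewrite sg => h; apply/negP => h'.
    have e : k' = k by apply: (inv_disjoint I h'); rewrite mem_cat h orbT.
    by rewrite e eqxx in nk.
  move=> k1 k2 b'; rewrite !getE.
  case: eqP => [->|/eqP n1]; case: eqP => [->|/eqP n2] //.
  + by move=> /(hg _ _ n2)/negbTE ->.
  + by move=> h /(hg _ _ n1); rewrite h.
  + by move=> h1 h2; apply: (inv_disjoint I h1 h2).
- exact: (inv_sp_opened I).
- exact: (inv_sp_uniq I).
- move=> b' hb'; rewrite loadE (inv_unopened I hb') add0r.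
  case: eqP => [e|_]; first by rewrite -e bo in hb'.
  case: ifP => [/ssP/(ok_opened G0)|]; last by rewrite addr0.
  by rewrite (negbTE hb').
- by rewrite /= x0; exact: (inv_placed I).
(* Standby replicas miss [small_prim], and [b] occurs there at most once. *)
- have -> : \sum_(b' <- small_prim st') load eta st' b' =
      \sum_(b' <- small_prim st) load eta st b' + x *+ (b \in small_prim st).
    under eq_bigr do rewrite loadE.
    rewrite big_split /=; congr (_ + _).
    rewrite big_seq (eq_bigr (fun b' => if b == b' then x else 0)); last first.
      by move=> b' /spS /negbTE ->; rewrite addr0.
    rewrite -big_seq -big_mkcond big_const_seq iter_addr_0; congr (_ *+ _).
    rewrite -(count_uniq_mem _ (inv_sp_uniq I)).
    by apply: eq_count => b' /=; rewrite eq_sym.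
  have := inv_sp_load I; rewrite gsE gsE' !big_cat !big_cons /= cg -/g0.
  case: ifP hb => _; last by case=> /negbTE -> _; rewrite addr0.
  by case=> -> -> /=; rewrite mulr1n; lra.
- have := inv_credit I; rewrite gsE gsE' !big_cat !big_cons /= -/g0 hcr; lra.
- have := inv_size I; rewrite gsE gsE' !big_cat !big_cons /= -/g0 cg; lia.
- move=> c; have := inv_incomplete I c; rewrite gsE gsE' !count_cat /= -/g0 cg ng.
  by apply: leq_trans; rewrite leq_add2l leq_add2r andbT; case: eqP => //=; case: (g_complete g).
- apply: leq_trans (inv_roomy I); apply: sub_count => b'.
  by rewrite /roomy; apply: le_trans.
Qed.

End Invariant.

(** * Capacities of super-replicas, and preservation of the invariant by placements *)

Section Steps.
Variables (R : realType) (f : nat) (eta : R).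
Hypothesis eta_gt1 : 1 < eta.
Implicit Types (st : state R) (g : group R) (c : nat * nat) (b k : nat).
Local Notation hs_inv := (@hs_inv R f eta).

Lemma sr_capacity_small : sr_capacity eta / 2 = (7 - eta^-1)^-1.
Proof.
have e1 := eta_gt1; have e0 := eta_gt0 eta_gt1.
by rewrite /sr_capacity; field; rewrite !gt_eqF //=; lra.
Qed.

Lemma standby_sr_capacityE : standby_sr_capacity eta = sr_capacity eta / eta.
Proof.
have e1 := eta_gt1; have e0 := eta_gt0 eta_gt1.
rewrite /standby_sr_capacity /sr_capacity; field.
by rewrite !gt_eqF //=; lra.
Qed.

Lemma density_full : density eta * (1 - sr_capacity eta) = 1.
Proof.
have e1 := eta_gt1; have e0 := eta_gt0 eta_gt1.
by rewrite /sr_capacity /density; field; rewrite !gt_eqF //=; lra.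
Qed.

Lemma density_stby_full :
  density eta * (1 - 2 * eta / (7 * eta - 1)) = 1.
Proof.
have e1 := eta_gt1; have e0 := eta_gt0 eta_gt1.
have -> : 2 * eta / (7 * eta - 1) = sr_capacity eta.
  by rewrite /sr_capacity; field; rewrite !gt_eqF //=; lra.
exact: density_full.
Qed.

Lemma count_le_sum (T : Type) (S : eqType) (h : T -> S) (P : pred T) (s : seq T)
    (cs : seq S) : all (fun x => h x \in cs) s ->
  (count P s <= \sum_(c <- cs) count (fun x => (h x == c) && P x) s)%N.
Proof.
elim: s => [|x s IH] //= /andP[hx /IH {}IH].
rewrite big_split /= leq_add //; case: (P x) => //.
by rewrite (big_rem _ hx) /= eqxx.
Qed.

Lemma count_incomplete st xs : hs_inv st xs ->
  (count (fun g => ~~ g_complete g) (groups st) <= class_count eta * f.+1)%N.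
Proof.
move=> I; pose cs := [seq (i, j) | i <- iota 0 8, j <- iota 0 (top_class eta).+2].
have hcs : all (fun g => g_class g \in cs) (groups st).
  apply/(all_nthP (group0 R)) => k hk; have := ok_class (inv_group I hk).
  rewrite -/(get_group st k); case: (g_class _) => i j /and3P[/= hi hj1 hj2].
  by apply/allpairsP; exists (i, j); rewrite !mem_iota; split=> //=; lia.
apply: leq_trans (count_le_sum _ hcs) _.
have -> : class_count eta = size cs by rewrite size_allpairs !size_iota.
rewrite mulnC -iter_addn_0 -(count_predT cs) -big_const_seq.
by apply: leq_sum => c _; apply: (inv_incomplete I).
Qed.

Lemma sumr_ge0_seq (T : Type) (s : seq T) (F : T -> R) :
  all (fun x => 0 <= F x) s -> 0 <= \sum_(x <- s) F x.
Proof.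
elim: s => [|x s IH] /=; first by rewrite big_nil.
by move=> /andP[x0 /IH]; rewrite big_cons; apply: addr_ge0.
Qed.

Lemma srs_total_ge0 st g : group_ok f eta st g -> 0 <= srs_total g.
Proof. by move=> G; apply/sumr_ge0_seq/allP => sr /(ok_srs G)[]. Qed.

(** Serves both occasions on which a committed bin is freed: a new super-replica, and completion of
    the group, for which the last premise supplies the clause of [group_kind]. *)
Lemma inv_release st xs k (cpl : bool) : hs_inv st xs -> (k < size (groups st))%N ->
  small (g_class (get_group st k)) -> ~~ g_complete (get_group st k) ->
  (cpl -> 1 <= density eta * (srs_total (get_group st k) / eta)) ->
  hs_inv (release st k cpl) xs.
Proof.
move=> I hk sk nk hc; have G0 := inv_group I hk.
rewrite /release; set g := Defs.Group _ _ _ _ _ _.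
have [l [r [gsE gsE']]] := groups_set_group hk.
have getE k' : get_group (set_group st k g) k' = if k' == k then g else get_group st k'.
  exact: get_set_group.
have gb k' : {subset bins (get_group (set_group st k g) k') <= bins (get_group st k')}.
  by move=> b; rewrite getE; case: eqP => [->|//]; rewrite /= [in X in _ -> X]mem_cat orbC => ->.
have okE g' : group_ok f eta st g' -> group_ok f eta (set_group st k g) g'.
  by move=> G; apply: (group_ok_mono G).
split; try by case: I.
- rewrite (size_set_group _ hk) => k' hk'; rewrite getE.
  case: eqP => _; last by apply/okE/(inv_group I hk').
  apply: okE; case: G0 => cl op sr cs sb kd; split => //.
    by move=> b bg; apply: op; rewrite mem_cat bg orbT.
  move: kd; rewrite /group_kind /= sk => -[_ h2 h3 _]; split => //.
- by move=> k1 k2 b /gb h1 /gb h2; apply: (inv_disjoint I h1 h2).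
- have := inv_sp_load I; rewrite gsE gsE' !big_cat !big_cons /=.
  by [].
- by have := inv_credit I; rewrite gsE gsE' !big_cat !big_cons.
- by have := inv_size I; rewrite gsE gsE' !big_cat !big_cons.
- move=> c; have := inv_incomplete I c; rewrite gsE gsE' !count_cat /= nk.
  apply: leq_trans; rewrite leq_add2l leq_add2r; case: eqP => //=.
  by case: cpl {hc g getE gb gsE' okE}.
Qed.

(** The bound is strict to leave room for the new bin, which is still empty. *)
Lemma inv_add_small_prim st xs b : hs_inv st xs -> fresh st [:: b] ->
  (count (roomy eta st) (small_prim st) < roomy_bound f eta)%N ->
  hs_inv (add_small_prim st b) xs.
Proof.
move=> I /andP[_ /= /andP[/andP[nb _] _]] hr.
have nsp : b \notin small_prim st by apply: contra nb; apply: (inv_sp_opened I).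
split; try by case: I.
- move=> k hk; apply: (group_ok_mono (inv_group I hk)) => //= b'.
  + by rewrite inE orbC => ->.
  + by rewrite inE orbC => ->.
  + by rewrite inE; case: eqP => // ->; rewrite (negbTE nb).
- by move=> b'; rewrite !inE => /orP[->//|/(inv_sp_opened I) ->]; rewrite orbT.
- by rewrite /= nsp; exact: (inv_sp_uniq I).
- by move=> b'; rewrite inE => /norP[_]; apply: (inv_unopened I).
- by rewrite /= big_cons [X in X + _](inv_unopened I nb) add0r; exact: (inv_sp_load I).
- by rewrite /= (inv_size I) addnS.
- rewrite /=; apply: leq_trans hr; rewrite -add1n leq_add2r.
  by case: (roomy _ _ _).
Qed.

Definition acts st : Prop := forall c, act_ok st c.

Lemma acts_set_group st k g : acts st ->
  g_class g = g_class (get_group st k) -> ~~ g_complete g ->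
  (k < size (groups st))%N -> acts (set_group st k g).
Proof.
move=> A cg ng hk c k' /= /(A c)[h1 h2 h3].
rewrite (size_set_group _ hk) get_set_group.
by case: eqP => [e|_]; split => //; rewrite cg -e.
Qed.

Lemma put_regular_inv st xs k x c : hs_inv st xs -> act_ok st c ->
  active st c = Some k -> valid_size x -> item_class eta x c -> ~~ small c ->
  hs_inv (put_regular f st k x) (x :: xs).
Proof.
move=> I A ak /andP[x0 x1] xc sc; have [hk gc ng] := A k ak.
have G := inv_group I hk.
have wE := item_class_regular f eta_gt1 x0 xc sc.
have := ok_class G; have := ok_kind G.
rewrite /group_kind gc (negbTE sc) => -[pc psp _] vc.
case: c => i j in A ak xc sc gc wE pc vc *.
have j0 : (0 < j)%N by case/and3P: vc.
rewrite /put_regular gc.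
have hw : nth 0%N (g_prim (get_group st k)) (g_count (get_group st k) %% j)
    \in g_prim (get_group st k) by rewrite mem_nth // pc ltn_mod.
apply: inv_place => //=.
- exact: ltW.
- move=> k' b' nk hb; apply/negP => hb'; case/eqP: nk.
  by apply: (inv_disjoint I hb'); rewrite mem_cat hb.
- by move=> b /mem_take/mem_drop.
- by apply: (ok_opened G); rewrite mem_cat hw.
- by rewrite gc (negbTE sc) psp.
- by rewrite /credit /= gc (negbTE sc) wE -natr1 mulrDl mul1r.
- case: G => cl op sr cs sb kd; split => //=.
  by rewrite /group_kind /= (negbTE sc); split => // /eqP.
Qed.

Lemma put_small_inv st xs k x b g c : hs_inv st xs ->
  (k < size (groups st))%N -> g_class (get_group st k) = c ->
  ~~ g_complete (get_group st k) ->
  valid_size x -> item_class eta x c -> small c ->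
  g_class g = c -> g_stby g = g_stby (get_group st k) -> ~~ g_complete g ->
  (size (g_prim g) <= 1)%N -> {subset g_prim g <= opened st} ->
  (forall k' b', k' != k -> b' \in g_prim g -> b' \notin bins (get_group st k')) ->
  b \in small_prim st ->
  srs_total g = srs_total (get_group st k) + x ->
  {in g_srs g, forall sr, sr.1 \in small_prim st /\ 0 <= sr.2} ->
  all (fun sr => sr_capacity eta / 2 <= sr.2) (behead (g_srs g)) ->
  hs_inv (add_placement (set_group st k g) (Placement x b (g_stby (get_group st k))))
    (x :: xs).
Proof.
move=> I hk gc ng /andP[x0 x1] xc sc cg sg ng' pg pog dg bsp tg srg clg.
have G := inv_group I hk.
apply: inv_place => //.
- exact: ltW.
- by rewrite gc.
- exact: (inv_sp_opened I).
- by rewrite gc sc.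
- by rewrite /credit cg gc sc tg (small_weight f eta_gt1 xc sc) mulrDr.
- split => //=.
  + by rewrite cg -gc; exact: (ok_class G).
  + move=> b'; rewrite mem_cat => /orP[/pog//|]; rewrite sg => h.
    by apply: (ok_opened G); rewrite mem_cat h orbT.
  + by rewrite sg; exact: (ok_stby G).
  + have := ok_kind G; rewrite /group_kind gc cg sc sg ng' => -[_ h2 h3 _].
    split=> // [b' hb'|]; last by rewrite (negbTE ng').
    rewrite load_place /= hb'.
    have -> : load eta (set_group st k g) b' = load eta st b' by [].
    rewrite h3 // tg mulrDl; case: eqP => [e|_]; last by rewrite add0r.
    by have := ok_stby G hb'; rewrite -e bsp.
Qed.

Lemma put_open_inv st xs k x c : hs_inv st xs -> act_ok st c ->
  active st c = Some k -> valid_size x -> item_class eta x c -> small c ->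
  fits_open eta (get_group st k) x ->
  hs_inv (put_open st k x) (x :: xs).
Proof.
move=> I A ak vx xc sc; have [hk gc ng] := A k ak.
have G := inv_group I hk; have := vx => /andP[x0 _].
rewrite /fits_open /put_open; case gE: (g_srs _) => [|[b v] srs] // _.
have [bsp v0] : b \in small_prim st /\ 0 <= v.
  by apply: (ok_srs G (_ : (b, v) \in _)); rewrite gE mem_head.
apply: (put_small_inv (c := c)) => //=.
- by have := ok_kind G; rewrite /group_kind gc sc ng => -[].
- by move=> b' hb'; apply: (ok_opened G); rewrite mem_cat hb'.
- move=> k' b' nk hb; apply/negP => hb'; case/eqP: nk.
  by apply: (inv_disjoint I hb'); rewrite mem_cat hb.
- by rewrite /srs_total /= gE !big_cons /=; ring.
- move=> sr; rewrite inE => /orP[/eqP -> /=|h]; first by rewrite addr_ge0 // ltW.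
  by apply: (ok_srs G); rewrite gE inE h orbT.
- by have := ok_closed G; rewrite gE.
Qed.

Lemma put_new_sr_inv st xs k b x c : hs_inv st xs ->
  (k < size (groups st))%N -> g_class (get_group st k) = c ->
  ~~ g_complete (get_group st k) ->
  valid_size x -> item_class eta x c -> small c ->
  all (fun sr => sr_capacity eta / 2 <= sr.2) (g_srs (get_group st k)) ->
  b \in small_prim st -> ~~ committed st b ->
  hs_inv (put_new_sr st k b x) (x :: xs).
Proof.
move=> I hk gc ng vx xc sc cl bsp nc; have G := inv_group I hk.
apply: (put_small_inv (c := c)) => //=.
- by move=> b'; rewrite inE => /eqP ->; exact: (inv_sp_opened I).
- move=> k' b' nk; rewrite inE => /eqP ->; apply/negP => hb.
  (* A bin of [small_prim] can belong to another group only as its committed bin, and [b] is not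
     committed. *)
  have hk' := bins_in_range hb; have G' := inv_group I hk'.
  move: hb; rewrite mem_cat => /orP[hb|/(ok_stby G')]; last by rewrite bsp.
  have := ok_kind G'; rewrite /group_kind; case: ifP => sk'; last first.
    by move=> [_ /(_ b hb)]; rewrite bsp.
  move=> _; case/negP: nc; apply/(has_nthP (group0 R)); exists k' => //.
  by rewrite -/(get_group st k') sk' hb.
- by rewrite /srs_total /= big_cons /= addrC.
- move=> sr; rewrite inE => /orP[/eqP -> /=|h]; last exact: (ok_srs G).
  by split => //; case/andP: vx => /ltW.
Qed.

End Steps.

(** * Roomy bins, complete runs, and the number of opened bins *)

Section OpenedBins.
Variables (R : realType) (f : nat) (eta : R).
Hypothesis eta_gt1 : 1 < eta.
Implicit Types (st : state R) (g : group R) (c : nat * nat) (b k : nat).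
Local Notation hs_inv := (@hs_inv R f eta).

Lemma committed_bins st xs : hs_inv st xs ->
  exists2 bs : seq nat, (size bs <= class_count eta * f.+1)%N &
    forall b, committed st b -> b \in bs.
Proof.
move=> I; pose prim g := if small (g_class g) then g_prim g else [::].
exists (flatten (map prim (groups st))).
  apply: leq_trans _ (count_incomplete eta_gt1 I).
  have : all (fun g => (size (prim g) <= ~~ g_complete g)%N) (groups st).
    apply/(all_nthP (group0 R)) => k hk; have := ok_kind (inv_group I hk).
    by rewrite /group_kind /prim -/(get_group st k); case: ifP => // _ [].
  elim: (groups st) => //= g gs IH /andP[hg /IH h].
  by rewrite size_cat leq_add.
move=> b; rewrite /committed; elim: (groups st) => //= g gs IH.
rewrite mem_cat => /orP[/andP[sg bg]|/IH ->]; last by rewrite orbT.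
by rewrite /prim sg bg.
Qed.

Lemma roomy_count st xs g : hs_inv st xs ->
  ~~ has (reusable eta st g) (small_prim st) ->
  (size (g_srs g) <= Num.truncn (7 * eta))%N ->
  (count (roomy eta st) (small_prim st) < roomy_bound f eta)%N.
Proof.
move=> I /hasPn hr hg; have [bs sbs hbs] := committed_bins I.
pose l := bs ++ undup (failed st) ++ [seq sr.1 | sr <- g_srs g].
have sl : (size l < roomy_bound f eta)%N.
  by rewrite /roomy_bound !size_cat size_map addnA addnS ltnS !leq_add // (inv_failed I).
apply: leq_ltn_trans sl; rewrite -size_filter.
apply: uniq_leq_size; first by rewrite filter_uniq // (inv_sp_uniq I).
move=> b; rewrite mem_filter => /andP[rb bsp].
have := hr b bsp; rewrite /reusable bsp /= !negb_and !negbK !mem_cat mem_undup.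
case/orP => [/hbs ->//|/orP[->|/orP[|->]]]; rewrite ?orbT //.
by move: rb; rewrite /roomy; lra.
Qed.

(** A small item takes at most half the capacity of a super-replica, so one that cannot hold it is
    more than half full. The standby capacity gives the same condition, scaled by [eta]. *)
Lemma not_fits_closed st xs k c x : hs_inv st xs -> act_ok st c ->
  active st c = Some k -> item_class eta x c -> small c ->
  ~~ fits_open eta (get_group st k) x ->
  all (fun sr => sr_capacity eta / 2 <= sr.2) (g_srs (get_group st k)).
Proof.
move=> I A ak xc sc; have [hk gc ng] := A k ak.
have e0 := eta_gt0 eta_gt1.
have := ok_closed (inv_group I hk); rewrite /fits_open.
case: (g_srs _) => [//|[b v] srs] /= -> hn; rewrite andbT.
have xs' := item_class_small xc sc; rewrite -sr_capacity_small // in xs'.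
move: hn; rewrite standby_sr_capacityE // ler_pM2r ?invr_gt0 // andbb -ltNge; lra.
Qed.

(** All mirroring bins carry the same load, and [0 < f] provides one from which to read it off. *)
Lemma mirrors_load st xs k : (0 < f)%N -> hs_inv st xs -> (k < size (groups st))%N ->
  small (g_class (get_group st k)) ->
  mirrors_have_space eta st (get_group st k) =
  (srs_total (get_group st k) / eta <= 1 - 2 * eta / (7 * eta - 1)).
Proof.
move=> f0 I hk sk; have := ok_kind (inv_group I hk).
rewrite /group_kind sk => -[_ sz hl _]; rewrite /mirrors_have_space.
apply/allP/idP => [h|h b bg]; last by rewrite hl //; lra.
have h0 : nth 0%N (g_stby (get_group st k)) 0 \in g_stby (get_group st k).
  by rewrite mem_nth // sz.
by have := h _ h0; rewrite hl //; lra.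
Qed.

(** Half-full super-replicas have size at least [1 / (7 - 1 / eta)], and their total is at most
    [eta] because the standby copies share one bin. *)
Lemma srs_count st xs k : (0 < f)%N -> hs_inv st xs -> (k < size (groups st))%N ->
  small (g_class (get_group st k)) ->
  mirrors_have_space eta st (get_group st k) ->
  all (fun sr => sr_capacity eta / 2 <= sr.2) (g_srs (get_group st k)) ->
  (size (g_srs (get_group st k)) <= Num.truncn (7 * eta))%N.
Proof.
move=> f0 I hk sk; rewrite (mirrors_load f0 I) // => hV hall.
have e1 := eta_gt1; have e0 := eta_gt0 eta_gt1.
have V1 : srs_total (get_group st k) <= eta.
  rewrite -[leRHS]mul1r -ler_pdivrMr //; apply: le_trans hV _.
  by rewrite lerBlDr lerDl divr_ge0; lra.
rewrite truncn_ge_nat; last by lra.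
have : (size (g_srs (get_group st k)))%:R * (sr_capacity eta / 2)
    <= srs_total (get_group st k).
  rewrite /srs_total; elim: (g_srs _) hall => [|sr srs IH] /=.
    by rewrite big_nil mul0r.
  move=> /andP[h /IH h']; rewrite big_cons -natr1 mulrDl mul1r; lra.
rewrite sr_capacity_small // => h.
have {}h := le_trans h V1.
have iE : eta^-1 < 1 by case/andP: (inv_eta eta_gt1).
move: h; rewrite ler_pdivrMr; last by lra.
rewrite mulrBr mulfV ?gt_eqF // => h; lra.
Qed.

Lemma open_sr_inv st xs k c x st' : (0 < f)%N -> hs_inv st xs -> acts st ->
  active st c = Some k -> valid_size x -> item_class eta x c -> small c ->
  ~~ fits_open eta (get_group st k) x ->
  mirrors_have_space eta st (get_group st k) ->
  open_sr eta (release st k false) k x st' ->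
  hs_inv st' (x :: xs) /\ acts st'.
Proof.
move=> f0 I A ak vx xc sc nf ms; have [hk gc ng] := A c k ak.
have sg : small (g_class (get_group st k)) by rewrite gc.
have cl := not_fits_closed I (A c) ak xc sc nf.
have ss := srs_count f0 I hk sg ms cl.
have I1 : hs_inv (release st k false) xs by apply: inv_release.
have gE : get_group (release st k false) k =
    Defs.Group (g_class (get_group st k)) [::] (g_stby (get_group st k))
      (g_count (get_group st k)) (g_srs (get_group st k)) false.
  by rewrite get_set_group eqxx.
have hk1 : (k < size (groups (release st k false)))%N by rewrite size_set_group.
have A1 : acts (release st k false) by apply: acts_set_group.
case=> [b /and5P[bsp nc _ _ _]|b nr fb].
  split; first by apply: (put_new_sr_inv (c := c) eta_gt1) => //; rewrite gE.
  by apply: acts_set_group => //; rewrite gE.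
have hr : (count (roomy eta (release st k false)) (small_prim (release st k false))
    < roomy_bound f eta)%N by apply: roomy_count I1 nr _; rewrite gE.
have I2 := inv_add_small_prim I1 fb hr.
split.
  apply: (put_new_sr_inv (c := c) eta_gt1) => //.
  - by rewrite -[get_group _ _]/(get_group (release st k false) k) gE.
  - by rewrite -[get_group _ _]/(get_group (release st k false) k) gE.
  - by rewrite -[get_group _ _]/(get_group (release st k false) k) gE.
  - exact: mem_head.
  case/andP: fb => _ /= /andP[/andP[nb _] _]; apply: contra nb => /(has_nthP (group0 R)).
  move=> [k' hk' /andP[_ hb]]; apply: (ok_opened (inv_group I1 hk')).
  by rewrite mem_cat hb.
apply: acts_set_group => //.
by rewrite /= -[get_group _ _]/(get_group (release st k false) k) gE.
Qed.

Lemma pack_small_inv st xs c x st' : (0 < f)%N -> hs_inv st xs -> acts st ->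
  valid_size x -> item_class eta x c -> small c ->
  pack_small f eta c x st st' -> hs_inv st' (x :: xs) /\ acts st'.
Proof.
(* Induction on the derivation, since an item may complete several groups before it is placed. *)
move=> f0 + + vx xc sc P; elim: P => {st st'} [st k ak fit|st k st' ak nf ms os|
  st k st1 st' ak nf nms sel _ IH] I A; have [hk gc ng] := A c k ak.
- split; first exact: (put_open_inv eta_gt1 I (A c) ak vx xc sc fit).
  move: fit; rewrite /put_open /fits_open; case: (g_srs _) => [//|[b v] srs] _.
  exact: acts_set_group.
- exact: (open_sr_inv f0 I A ak vx xc sc nf ms os).
- have sg : small (g_class (get_group st k)) by rewrite gc.
  have I1 : hs_inv (release st k true) xs.
    (* Completion means that the mirroring bins lack space, so [density] times their load is at
       least 1. *)
    apply: inv_release => // _; move: nms.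
    have e0 := eta_gt0 eta_gt1; have /andP[d1 _] := density_bounds eta_gt1.
    rewrite (mirrors_load f0 I) // -ltNge => /ltW h.
    by rewrite -(density_stby_full eta_gt1) ler_wpM2l //; lra.
  have A1 c' : c' != c -> act_ok (release st k true) c'.
    move=> nc k' /= /(A c')[h1 h2 h3]; rewrite (size_set_group _ hk) get_set_group.
    by case: eqP => [e|//]; move: nc; rewrite -h2 -gc e eqxx.
  have [I2 A2] := inv_select eta_gt1 I1 (item_class_valid eta_gt1 xc) A1 sel.
  exact: IH.
Qed.

Lemma pack_regular_inv st xs c x st' : hs_inv st xs -> acts st ->
  valid_size x -> item_class eta x c -> ~~ small c ->
  pack_regular f st c x st' -> hs_inv st' (x :: xs) /\ acts st'.
Proof.
move=> I A vx xc sc.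
have key k : active st c = Some k -> hs_inv (put_regular f st k x) (x :: xs).
  by move=> ak; apply: (put_regular_inv eta_gt1 I (A c)).
have act k c' : active st c = Some k ->
    c' != c \/ ~~ g_complete (get_group (put_regular f st k x) k) ->
    act_ok (put_regular f st k x) c'.
  move=> ak; have [hk gc ng] := A c k ak.
  rewrite /put_regular gc; case: c {key} gc => i j /= gc in sc xc ak ng * => h k' /=.
  move=> /(A c')[h1 h2 h3]; rewrite (size_set_group _ hk).
  move: h; set g := Defs.Group _ _ _ _ _ _.
  rewrite -![get_group (add_placement _ _) _]/(get_group (set_group st k g) _).
  rewrite !get_set_group eqxx; case: (k' =P k) => [e|//] h.
  split => //; first by rewrite -h2 e gc.
  by case: h => //; rewrite -h2 e gc eqxx.
case=> [k ak nc|k st1 ak cp sel].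
  by split; [exact: key | move=> c'; apply: act => //; right].
apply: (inv_select eta_gt1 (key k ak) (item_class_valid eta_gt1 xc)) sel.
by move=> c' nc; apply: act => //; left.
Qed.

Lemma arrive_inv st xs x st' : (0 < f)%N -> hs_inv st xs -> acts st -> valid_size x ->
  arrive f eta st x st' -> hs_inv st' (x :: xs) /\ acts st'.
Proof.
move=> f0 I A vx [c [st1 [xc ac]]].
have [I1 A1] : hs_inv st1 xs /\ acts st1.
  move: ac; rewrite /activate; case: (active st c) => [_ ->//|].
  by apply: (inv_select eta_gt1) => //; apply: (item_class_valid eta_gt1 xc).
case: ifP => [sc|/negbT sc]; [exact: (pack_small_inv f0) | exact: pack_regular_inv].
Qed.

Lemma reselect_inv st xs st' : hs_inv st xs -> acts st ->
  reselect f st st' -> hs_inv st' xs /\ acts st'.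
Proof.
move=> + + P; elim: P => {st st'} [//|st c st1 st' br sel _ IH] I A.
have [I1 A1] : hs_inv st1 xs /\ acts st1; last exact: IH.
apply: (inv_select eta_gt1 I) sel => //.
move: br; rewrite /broken; case ak: (active st c) => [k|] // _.
by have [hk <- _] := A c k ak; apply: (ok_class (inv_group I hk)).
Qed.

Lemma run_inv evs st xs st' : (0 < f)%N -> hs_inv st xs -> acts st ->
  all (valid_event f) evs -> run f eta st evs st' ->
  hs_inv st' (rev (items evs) ++ xs).
Proof.
move=> f0; elim: evs st xs => [|e evs IH] st xs I A /=; first by move=> _ ->.
move=> /andP[ve vevs] [st1 hst1].
case: e ve hst1 => [x|F] /= ve hst1.
  have [I1 A1] := arrive_inv f0 I A ve hst1.
  by rewrite rev_cons cat_rcons; exact: IH.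
have [I1 A1] := reselect_inv (inv_set_failed I ve) A hst1.
exact: IH.
Qed.

Lemma hs_inv_init : hs_inv (init R) [::].
Proof.
split => //=; rewrite ?big_nil //.
- by move=> k1 k2 b; rewrite /get_group nth_default.
- by move=> b _; rewrite /load !big_nil addr0.
Qed.

Definition group_bound : nat := ((top_class eta).+1 + 7 * f)%N.

(** The primary part of the credit of small items is set aside for the primary bins, which groups
    share over time; the standby part pays for the [f] mirroring bins. An incomplete group is
    covered by [group_bound]. *)
Lemma group_size_credit st g : group_ok f eta st g ->
  (group_size f (g_class g))%:R <=
  credit f eta g - (if small (g_class g) then density eta * srs_total g else 0)
    + (~~ g_complete g * group_bound)%:R.
Proof.
move=> G; have e0 := ltW (eta_gt0 eta_gt1).
have /andP[/(le_trans ler01) d0 _] := density_bounds eta_gt1.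
have vc := ok_class G.
have bound : (group_size f (g_class g))%:R <= group_bound%:R :> R.
  rewrite ler_nat /group_size /group_bound.
  by case: (g_class g) vc => i j /and3P[/= /andP[_ i7] _ jt]; case: ifP => _; nia.
have := ok_kind G; have V0 := srs_total_ge0 G.
rewrite /group_kind /credit /group_size in bound *.
case: ifP bound => [sc|sc] bound; [move=> [_ _ _ h3] | move=> [_ _ h3]].
  have W0 : 0 <= density eta * (srs_total g / eta).
    by apply: mulr_ge0 => //; apply: divr_ge0.
  have -> : small_rate f eta * srs_total g - density eta * srs_total g =
      f%:R * (density eta * (srs_total g / eta)) by rewrite /small_rate; ring.
  case: (g_complete g) h3 => /= [/(_ isT) h|_]; first by rewrite mul0n addr0 ler_peMr.
  by rewrite mul1n; apply: le_trans bound _; rewrite lerDr mulr_ge0.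
rewrite subr0; case: (g_complete g) h3 => /= [/(_ isT) ->|_].
  case: (g_class g) vc => i j /and3P[/= /andP[i0 _] j0 _].
  rewrite mul0n addr0 natrD !natrM le_eqVlt; apply/orP; left; apply/eqP.
  by field; rewrite !pnatr_eq0; lia.
rewrite mul1n; apply: le_trans bound _; rewrite lerDr mulr_ge0 //.
by rewrite addr_ge0 ?mulr_ge0 ?invr_ge0.
Qed.

(** By [density_full], a bin that is not roomy pays for itself. *)
Lemma size_small_prim st xs : hs_inv st xs ->
  (size (small_prim st))%:R <= (roomy_bound f eta)%:R +
    density eta * \sum_(b <- small_prim st) load eta st b.
Proof.
move=> I; have /andP[d1 _] := density_bounds eta_gt1.
have hr : (count (roomy eta st) (small_prim st))%:R <= (roomy_bound f eta)%:R :> R.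
  by rewrite ler_nat (inv_roomy I).
apply: le_trans (_ : (count (roomy eta st) (small_prim st))%:R +
   density eta * \sum_(b <- small_prim st) load eta st b <= _); last by lra.
elim: (small_prim st) => [|b bs IH] /=; first by rewrite big_nil mulr0 addr0.
rewrite big_cons mulrDr -natr1 natrD.
suff : 1 <= (roomy eta st b)%:R + density eta * load eta st b by lra.
have l0 := load_ge0 eta_gt1 b (inv_placed I).
have [_|] := boolP (roomy eta st b); first by rewrite lerDl mulr_ge0; lra.
rewrite /roomy -ltNge => /ltW h; rewrite add0r -(density_full eta_gt1).
by rewrite ler_wpM2l; lra.
Qed.

(** The credit set aside in [group_size_credit] is what [inv_sp_load] passes on to the primary bins
    of small items. *)
Lemma opened_bound st xs : hs_inv st xs ->
  (bins_opened st)%:R <= \sum_(x <- xs) weight f eta x +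
    (group_bound * (class_count eta * f.+1) + roomy_bound f eta)%:R.
Proof.
move=> I; have hsp := size_small_prim I; have hc := inv_credit I.
have hl := inv_sp_load I; have hi := count_incomplete eta_gt1 I.
have /andP[d1 _] := density_bounds eta_gt1.
rewrite /bins_opened (inv_size I) natrD.
have hg : (\sum_(g <- groups st) group_size f (g_class g))%:R <=
    \sum_(g <- groups st) credit f eta g -
    density eta * \sum_(g <- groups st | small (g_class g)) srs_total g +
    (group_bound * count (fun g => ~~ g_complete g) (groups st))%:R.
  have : all (fun g => (group_size f (g_class g))%:R <=
    credit f eta g - (if small (g_class g) then density eta * srs_total g else 0)
    + (~~ g_complete g * group_bound)%:R) (groups st).
    apply/(all_nthP (group0 R)) => k hk.
    by apply: group_size_credit; apply: (inv_group I hk).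
  move: group_bound => bd; elim: (groups st) => [|g gs IH] /=.
    by rewrite !big_nil mulr0 muln0 subr0 addr0.
  move=> /andP[hg /IH {}IH]; rewrite !big_cons mulnDr !natrD.
  rewrite mulnC in hg; move: hg IH; case: ifP => _; lra.
have hm : (group_bound * count (fun g => ~~ g_complete g) (groups st))%:R <=
   (group_bound * (class_count eta * f.+1))%:R :> R by rewrite ler_nat leq_mul2l hi orbT.
have hd : density eta * \sum_(b <- small_prim st) load eta st b <=
   density eta * \sum_(g <- groups st | small (g_class g)) srs_total g.
  by rewrite ler_wpM2l //; lra.
rewrite natrD; lra.
Qed.

End OpenedBins.

(** * Comparison of the opened bins with the optimum through the total weight *)

Theorem theorem2 (R : realType) (f : nat) (eta : R)
    (hf : (1 < f)%N) (heta : 1 < eta) :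
  exists c : R,
    forall (evs : seq (event R)) (st : state R),
      all (valid_event f) evs ->
      run f eta (init R) evs st ->
      (bins_opened st)%:R <= 7 / 4 * (Opt f eta (items evs))%:R + c.
Proof.
have f0 : (0 < f)%N by apply: ltnW.
exists (group_bound f eta * (class_count eta * f.+1) + roomy_bound f eta)%:R.
move=> evs st vevs hrun.
have A0 : acts (init R) by [].
have I := run_inv heta f0 (hs_inv_init f eta) A0 vevs hrun.
apply: le_trans (opened_bound heta I) _; rewrite lerD2r.
(* The invariant lists the items in reverse order of arrival. *)
rewrite cats0 big_rev /=.
apply: weight_le_Opt => //.
elim: evs vevs {hrun I} => [|[x|F] evs IH] //= /andP[vx /IH] //.
by rewrite vx.
Qed.
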